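(* Every $\mathbb{C}$-algebra automorphism $\phi$ of the first Weyl algebra $A_1$ admits a lift to an endomorphism of $A^{(t)}_1$, i.e. there is an $R$-algebra endomorphism $\widetilde{\phi}$ of $A^{(t)}_1$ with $(\widetilde{\phi})_1=\phi$.
   Context: Let $A_1=\mathbb{C}\langle x,\partial\rangle/(\partial x-x\partial-1)$ be the first Weyl algebra. Let $R=\mathbb{C}[t,t^{-1}]$ and $A^{(t)}_1=R\langle x,\partial\rangle/(\partial x-t x\partial-1)$. Then $A^{(t)}_1/(t-1)=A_1$, and for an $R$-algebra endomorphism $\psi$ of $A^{(t)}_1$, $(\psi)_1$ denotes the $\mathbb{C}$-algebra endomorphism of $A_1$ obtained from $\psi$ by reduction modulo $t-1$. *)

(* Defs.v *)
From HB Require Import structures.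
From mathcomp Require Import all_boot all_order all_algebra.
From mathcomp Require Import finmap.
From mathcomp.multinomials Require Import monalg.
From mathcomp Require Import boolp reals complex.

Set Implicit Arguments.
Unset Strict Implicit.
Unset Printing Implicit Defensive.

Import GRing.Theory.
Local Open Scope ring_scope.
Local Open Scope quotient_scope.

(* Quotient of a not necessarily commutative ring by the two-sided ideal
   generated by one element.  MathComp's ring_quotient only provides ring
   structures on quotients of commutative rings. *)

Section TwoSidedIdeal.
Variables (A : nzRingType) (r : A).

Definition tsideal : {pred A} := fun u =>
  `[< exists s : seq (A * A), u = \sum_(p <- s) p.1 * r * p.2 >].

Lemma tsidealP u :
  reflect (exists s : seq (A * A), u = \sum_(p <- s) p.1 * r * p.2)
          (u \in tsideal).
Proof. exact: asboolP. Qed.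

Lemma tsideal_gen : r \in tsideal.
Proof. by apply/tsidealP; exists [:: (1, 1)]; rewrite big_seq1 mul1r mulr1. Qed.

Lemma tsideal_zmod_closed : zmod_closed tsideal.
Proof.
split; first by apply/tsidealP; exists [::]; rewrite big_nil.
move=> u v /tsidealP[s ->] /tsidealP[s' ->]; apply/tsidealP.
exists (s ++ [seq (- p.1, p.2) | p <- s']).
rewrite big_cat big_map -sumrN; congr (_ + _).
by apply: eq_bigr => p _; rewrite !mulNr.
Qed.

HB.instance Definition _ :=
  GRing.isZmodClosed.Build A tsideal tsideal_zmod_closed.

Lemma tsidealMl a u : u \in tsideal -> a * u \in tsideal.
Proof.
move=> /tsidealP[s ->]; apply/tsidealP; exists [seq (a * p.1, p.2) | p <- s].
by rewrite big_map mulr_sumr; apply: eq_bigr => p _; rewrite !mulrA.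
Qed.

Lemma tsidealMr a u : u \in tsideal -> u * a \in tsideal.
Proof.
move=> /tsidealP[s ->]; apply/tsidealP; exists [seq (p.1, p.2 * a) | p <- s].
by rewrite big_map mulr_suml; apply: eq_bigr => p _; rewrite !mulrA.
Qed.

Definition tsquot := Quotient.quot tsideal.
HB.instance Definition _ := Choice.on tsquot.
HB.instance Definition _ := GRing.Zmodule.on tsquot.
HB.instance Definition _ : EqQuotient A (Quotient.equiv tsideal) tsquot :=
  EqQuotient.on tsquot.

Definition tsproj : A -> tsquot := \pi_tsquot.

Lemma tsproj_eq u v : (tsproj u == tsproj v) = (u - v \in tsideal).
Proof. by rewrite Quotient.idealrBE. Qed.

Lemma tsproj_repr (u : tsquot) : tsproj (repr u) = u.
Proof. exact: reprK. Qed.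

Lemma tsproj_is_zmod_morphism : zmod_morphism tsproj.
Proof. by move=> u v; rewrite /tsproj !piE. Qed.

Definition tsone : tsquot := tsproj 1.
Definition tsmul : tsquot -> tsquot -> tsquot := lift_op2 tsquot *%R.

Lemma tsprojM u v : tsmul (tsproj u) (tsproj v) = tsproj (u * v).
Proof.
unlock tsmul; apply/eqP; rewrite tsproj_eq.
move: (repr (tsproj u)) (tsproj_repr (tsproj u)) => u' /eqP; rewrite tsproj_eq => hu.
move: (repr (tsproj v)) (tsproj_repr (tsproj v)) => v' /eqP; rewrite tsproj_eq => hv.
have -> : u' * v' - u * v = (u' - u) * v' + u * (v' - v).
  by rewrite mulrBl mulrBr addrA subrK.
by apply: rpredD; [apply: tsidealMr | apply: tsidealMl].
Qed.

Lemma tsmulA : associative tsmul.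
Proof.
by move=> u v w; rewrite -[u]tsproj_repr -[v]tsproj_repr -[w]tsproj_repr !tsprojM mulrA.
Qed.
Lemma ts1mul : left_id tsone tsmul.
Proof. by move=> u; rewrite -[u]tsproj_repr tsprojM mul1r. Qed.
Lemma tsmul1 : right_id tsone tsmul.
Proof. by move=> u; rewrite -[u]tsproj_repr tsprojM mulr1. Qed.
Lemma tsprojD u v : tsproj (u + v) = tsproj u + tsproj v.
Proof. by rewrite /tsproj !piE. Qed.
Lemma tsmulDl : left_distributive tsmul +%R.
Proof.
move=> u v w; rewrite -[u]tsproj_repr -[v]tsproj_repr -[w]tsproj_repr.
by rewrite -tsprojD !tsprojM mulrDl tsprojD.
Qed.
Lemma tsmulDr : right_distributive tsmul +%R.
Proof.
move=> u v w; rewrite -[u]tsproj_repr -[v]tsproj_repr -[w]tsproj_repr.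
by rewrite -tsprojD !tsprojM mulrDr tsprojD.
Qed.

HB.instance Definition _ :=
  GRing.Zmodule_isPzRing.Build tsquot tsmulA ts1mul tsmul1 tsmulDl tsmulDr.

HB.instance Definition _ :=
  GRing.isZmodMorphism.Build A tsquot tsproj tsproj_is_zmod_morphism.
Lemma tsproj_is_monoid_morphism : monoid_morphism tsproj.
Proof. by split=> // u v; rewrite -tsprojM. Qed.
HB.instance Definition _ :=
  GRing.isMonoidMorphism.Build A tsquot tsproj tsproj_is_monoid_morphism.

End TwoSidedIdeal.

Section FreeAlgebra.
Variables (I : choiceType) (K : comNzRingType).

Lemma malg_fmonom_scaleAr (a : K) (u v : {malg K[{fmonom I}]}) :
  a *: (u * v) = u * (a *: v).
Proof.
suff cC : a%:MP * u = u * a%:MP.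
  rewrite -(mul_malgC a (u * v)) mulrA [X in X * v]cC -mulrA (mul_malgC a v).
  reflexivity.
rewrite [u]monalgE mulr_sumr mulr_suml; apply: eq_bigr => m _.
by rewrite !malgM_def !fgmulUU mul1m mulm1 mulrC.
Qed.

End FreeAlgebra.

Section QWeyl.
Variable K : comNzRingType.

(* K<x, d>: the monoid algebra of the free monoid on two letters. *)
Local Notation free2 := {malg K[{fmonom 'I_2}]}.

Definition fx : free2 := << fmu (0 : 'I_2) >>.
Definition fd : free2 := << fmu (1 : 'I_2) >>.

Variable q : K.

(* qweyl = K<x, d> / (d x - q x d - 1). *)
Definition qweyl_rel : free2 := fd * fx - q *: (fx * fd) - 1.

Definition qweyl := tsquot qweyl_rel.
HB.instance Definition _ := GRing.PzRing.on qweyl.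

Definition qweyl_pi : free2 -> qweyl := @tsproj free2 qweyl_rel.
HB.instance Definition _ := GRing.RMorphism.on qweyl_pi.

Lemma qweyl_pi_eq u v :
  (qweyl_pi u == qweyl_pi v) = (u - v \in tsideal qweyl_rel).
Proof. exact: tsproj_eq. Qed.

Lemma qweyl_pi_repr (u : qweyl) : qweyl_pi (repr u) = u.
Proof. exact: tsproj_repr. Qed.

Lemma qweyl_piB u v : qweyl_pi (u - v) = qweyl_pi u - qweyl_pi v.
Proof. exact: rmorphB. Qed.
Lemma qweyl_piM u v : qweyl_pi (u * v) = qweyl_pi u * qweyl_pi v.
Proof. exact: rmorphM. Qed.
Lemma qweyl_pi0 : qweyl_pi 0 = 0.
Proof. exact: rmorph0. Qed.
Lemma qweyl_pi1 : qweyl_pi 1 = 1.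
Proof. exact: rmorph1. Qed.

(* x acts on sequences by shift, d by weighted shift with the q-integers as
   weights; this representation shows that the quotient is nontrivial. *)
Fixpoint qint n : K := if n is n'.+1 then 1 + q * qint n' else 0.

Definition seq_act (i : 'I_2) (f : nat -> K) (n : nat) : K :=
  if val i == 0%N then (if n is n'.+1 then f n' else 0)
  else qint n.+1 * f n.+1.

Definition word_act (m : {fmonom 'I_2}) f := foldr seq_act f (m : seq 'I_2).

Definition free2_act (u : free2) (f : nat -> K) (n : nat) : K :=
  mmap (idfun : K -> K) (fun m => word_act m f n) u.

Lemma word_act_sum (I : Type) (s : seq I) (c : I -> K) (g : I -> nat -> K) m n :
  word_act m (fun k => \sum_(i <- s) c i * g i k) n =
  \sum_(i <- s) c i * word_act m (g i) n.
Proof.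
rewrite /word_act; elim: {m}(m : seq 'I_2) n => //= a l IH n.
rewrite /seq_act; case: ifP => _.
  by case: n => [|n]; rewrite ?IH // big1 // => i _; rewrite mulr0.
by rewrite IH mulr_sumr; apply: eq_bigr => i _; rewrite mulrCA.
Qed.

Lemma word_act_ext m f g : f =1 g -> word_act m f =1 word_act m g.
Proof.
move=> fg; rewrite /word_act; elim: {m}(m : seq 'I_2) => //= a l IH n.
by rewrite /seq_act; case: ifP => _; rewrite ?IH //; case: n.
Qed.

Lemma free2_actE u f n :
  free2_act u f n = \sum_(m <- msupp u) u@_m * word_act m f n.
Proof. by []. Qed.

Lemma free2_act_sum (I : Type) (s : seq I) (F : I -> free2) f n :
  free2_act (\sum_(i <- s) F i) f n = \sum_(i <- s) free2_act (F i) f n.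
Proof. by rewrite /free2_act raddf_sum. Qed.

Lemma free2_actU c m f n :
  free2_act << c *g m >> f n = c * word_act m f n.
Proof. by rewrite /free2_act mmapU. Qed.

Lemma free2_actM u v f n :
  free2_act (u * v) f n = free2_act u (free2_act v f) n.
Proof.
rewrite malgME free2_act_sum [RHS]free2_actE; apply: eq_bigr => m _.
rewrite free2_act_sum.
rewrite (word_act_ext m (free2_actE v f)) word_act_sum mulr_sumr.
apply: eq_bigr => m' _; rewrite free2_actU mulrA; congr (_ * _).
by rewrite /word_act fmM foldr_cat.
Qed.

Lemma free2_act_ext u f g : f =1 g -> free2_act u f =1 free2_act u g.
Proof.
by move=> fg n; apply: eq_bigr => m _; rewrite (word_act_ext m fg).
Qed.

Lemma free2_act0 u n : free2_act u (fun=> 0) n = 0.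
Proof.
apply: big1 => m _ /=.
have := @word_act_sum nat [::] (fun=> 0) (fun _ _ => 0) m n.
rewrite (@word_act_ext m _ (fun=> 0)) => [->|k]; last by rewrite big_nil.
by rewrite big_nil mulr0.
Qed.

Lemma free2_actB u v f n :
  free2_act (u - v) f n = free2_act u f n - free2_act v f n.
Proof. by rewrite /free2_act raddfB. Qed.

Lemma free2_act1 f n : free2_act 1 f n = f n.
Proof. by rewrite free2_actU mul1r /word_act fm1. Qed.

Lemma free2_actZ c u f n : free2_act (c *: u) f n = c * free2_act u f n.
Proof. by rewrite -(mul_malgC c u) free2_actM free2_actU /word_act fm1. Qed.

Lemma free2_actx f n : free2_act fx f n = if n is n'.+1 then f n' else 0.
Proof. by rewrite free2_actU mul1r /word_act fmU. Qed.

Lemma free2_actd f n : free2_act fd f n = qint n.+1 * f n.+1.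
Proof. by rewrite free2_actU mul1r /word_act fmU. Qed.

Lemma free2_act_rel f : free2_act qweyl_rel f =1 fun=> 0.
Proof.
move=> n; rewrite /qweyl_rel (free2_actB _ 1) (free2_actB (fd * fx)) free2_actZ.
rewrite [X in X - _ - _]free2_actM [X in _ * X]free2_actM [X in _ - X]free2_act1.
rewrite free2_actd !free2_actx.
case: n => [|n]; first by rewrite /= !mulr0 addr0 subr0 mul1r subrr.
by rewrite free2_actd [qint n.+2]/= mulrDl mul1r mulrA addrK subrr.
Qed.

Lemma qweyl_nontrivial : (1 : qweyl) != 0.
Proof.
rewrite -(rmorph1 qweyl_pi) -(rmorph0 qweyl_pi) qweyl_pi_eq subr0.
apply/tsidealP=> -[s] /(congr1 (fun u => free2_act u (fun=> 1) 0%N)).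
rewrite free2_act_sum big1 => [/eqP|p _].
  by rewrite free2_actU /word_act fm1 mul1r oner_eq0.
rewrite !free2_actM.
rewrite (@free2_act_ext _ _ (fun=> 0)) ?free2_act0 // => n.
by rewrite free2_act_rel.
Qed.

HB.instance Definition _ :=
  GRing.PzSemiRing_isNonZero.Build qweyl qweyl_nontrivial.

Definition qweyl_scale (a : K) : qweyl -> qweyl := lift_op1 qweyl ( *:%R a).

Lemma qweyl_piZ a u : qweyl_scale a (qweyl_pi u) = qweyl_pi (a *: u).
Proof.
unlock qweyl_scale; apply/eqP; rewrite qweyl_pi_eq -scalerBr.
rewrite -[_ - u]mul1r scalerAl; apply: tsidealMl.
by rewrite -qweyl_pi_eq qweyl_pi_repr.
Qed.

Lemma qweyl_scaleA a b u :
  qweyl_scale a (qweyl_scale b u) = qweyl_scale (a * b) u.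
Proof. by rewrite -[u]qweyl_pi_repr !qweyl_piZ scalerA. Qed.
Lemma qweyl_scale1 : left_id 1 qweyl_scale.
Proof. by move=> u; rewrite -[u]qweyl_pi_repr !qweyl_piZ scale1r. Qed.
Lemma qweyl_scaleDr : right_distributive qweyl_scale +%R.
Proof.
move=> a u v; rewrite -[u]qweyl_pi_repr -[v]qweyl_pi_repr -rmorphD !qweyl_piZ.
by rewrite scalerDr rmorphD.
Qed.
Lemma qweyl_scaleDl u : {morph qweyl_scale^~ u : a b / a + b}.
Proof.
by move=> a b; rewrite -[u]qweyl_pi_repr !qweyl_piZ scalerDl rmorphD.
Qed.
HB.instance Definition _ := GRing.Zmodule_isLmodule.Build K qweyl
  qweyl_scaleA qweyl_scale1 qweyl_scaleDr qweyl_scaleDl.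

Lemma qweyl_piZE a u : qweyl_pi (a *: u) = a *: qweyl_pi u.
Proof. by rewrite [RHS]qweyl_piZ. Qed.
Lemma qweyl_pi_is_scalable : scalable qweyl_pi.
Proof. exact: qweyl_piZE. Qed.
HB.instance Definition _ :=
  GRing.isScalable.Build K free2 qweyl *:%R qweyl_pi qweyl_pi_is_scalable.

Lemma qweyl_scaleAl (a : K) (u v : qweyl) : a *: (u * v) = (a *: u) * v.
Proof.
rewrite -[u]qweyl_pi_repr -[v]qweyl_pi_repr -(rmorphM qweyl_pi).
by rewrite -!qweyl_piZE -(rmorphM qweyl_pi) scalerAl.
Qed.
HB.instance Definition _ := GRing.Lmodule_isLalgebra.Build K qweyl qweyl_scaleAl.
Lemma qweyl_scaleAr (a : K) (u v : qweyl) : a *: (u * v) = u * (a *: v).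
Proof.
rewrite -[u]qweyl_pi_repr -[v]qweyl_pi_repr -(rmorphM qweyl_pi).
by rewrite -!qweyl_piZE -(rmorphM qweyl_pi) malg_fmonom_scaleAr.
Qed.
HB.instance Definition _ := GRing.Lalgebra_isAlgebra.Build K qweyl qweyl_scaleAr.

Definition qx : qweyl := qweyl_pi fx.
Definition qd : qweyl := qweyl_pi fd.

Lemma qweylE : qd * qx = q *: (qx * qd) + 1.
Proof.
apply/eqP; rewrite -subr_eq0 opprD addrA /qd /qx -!rmorphM -linearZ -rmorphB.
by rewrite -(rmorph1 qweyl_pi) -rmorphB -(rmorph0 qweyl_pi) qweyl_pi_eq subr0
           tsideal_gen.
Qed.

End QWeyl.

(* F[t, t^-1], as the subring of F(t) of fractions whose denominator is a
   power of t. *)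

Section Laurent.
Variable F : fieldType.

Local Notation tofrac := (@FracField.tofrac {poly F}).

Definition laurent_pred : {pred {fraction {poly F}}} := fun f =>
  `[< exists (p : {poly F}) n, f = tofrac p / tofrac 'X ^+ n >].

Lemma laurent_predP f :
  reflect (exists (p : {poly F}) n, f = tofrac p / tofrac 'X ^+ n)
          (f \in laurent_pred).
Proof. exact: asboolP. Qed.

Lemma tofracX_neq0 : tofrac 'X != 0.
Proof. by rewrite tofrac_eq0 polyX_eq0. Qed.
Lemma tofracXn_neq0 n : tofrac 'X ^+ n != 0.
Proof. by rewrite expf_neq0 // tofracX_neq0. Qed.

Lemma laurent_subring_closed : subring_closed laurent_pred.
Proof.
split.
- by apply/laurent_predP; exists 1, 0%N; rewrite rmorph1 expr0 divr1.
- move=> _ _ /laurent_predP[p [n ->]] /laurent_predP[p' [n' ->]].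
  apply/laurent_predP; exists (p * 'X^n' - p' * 'X^n), (n + n')%N.
  rewrite -mulNr addf_div ?tofracXn_neq0 // rmorphB !rmorphM /= !rmorphXn /=.
  by rewrite mulNr exprD.
- move=> _ _ /laurent_predP[p [n ->]] /laurent_predP[p' [n' ->]].
  apply/laurent_predP; exists (p * p'), (n + n')%N.
  by rewrite rmorphM mulf_div exprD.
Qed.
HB.instance Definition _ :=
  GRing.isSubringClosed.Build _ laurent_pred laurent_subring_closed.

Record laurent := Laurent {
  laurent_val : {fraction {poly F}};
  _ : laurent_val \in laurent_pred
}.
HB.instance Definition _ := [isSub for laurent_val].
HB.instance Definition _ := [Choice of laurent by <:].
HB.instance Definition _ := [SubChoice_isSubComNzRing of laurent by <:].

Lemma laurentP (f : laurent) :
  exists pn : {poly F} * nat, val f = tofrac pn.1 / tofrac 'X ^+ pn.2.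
Proof. by case: f => f /= /laurent_predP[p [n ->]]; exists (p, n). Qed.

Lemma laurent_poly_subproof p : tofrac p \in laurent_pred.
Proof. by apply/laurent_predP; exists p, 0%N; rewrite expr0 divr1. Qed.
Definition laurent_poly (p : {poly F}) : laurent :=
  Laurent (laurent_poly_subproof p).

Lemma laurent_poly_is_zmod_morphism : zmod_morphism laurent_poly.
Proof. by move=> p p'; apply: val_inj; rewrite /= rmorphB. Qed.
HB.instance Definition _ := GRing.isZmodMorphism.Build {poly F} laurent
  laurent_poly laurent_poly_is_zmod_morphism.
Lemma laurent_poly_is_monoid_morphism : monoid_morphism laurent_poly.
Proof.
by split=> [|p p']; apply: val_inj; rewrite /= ?rmorph1 ?rmorphM.
Qed.
HB.instance Definition _ := GRing.isMonoidMorphism.Build {poly F} laurent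
  laurent_poly laurent_poly_is_monoid_morphism.

Definition laurentT : laurent := laurent_poly 'X.

Lemma laurentV_subproof : (tofrac 'X)^-1 \in laurent_pred.
Proof.
by apply/laurent_predP; exists 1, 1%N; rewrite expr1 rmorph1 mul1r.
Qed.
Definition laurentV : laurent := Laurent laurentV_subproof.

Lemma laurentTV : laurentT * laurentV = 1.
Proof. by apply: val_inj; rewrite /= mulfV // tofracX_neq0. Qed.

Lemma laurentE (f : laurent) : exists p n, f = laurent_poly p * laurentV ^+ n.
Proof.
have [[p n] /= fE] := laurentP f; exists p, n; apply: val_inj.
by rewrite [LHS]fE rmorphM rmorphXn /= exprVn.
Qed.

(* Evaluation at t = 1; the value does not depend on the chosen presentation
   p / t^n, by eval1_laurentE. *)
Definition eval1 (f : laurent) : F := (projT1 (cid (laurentP f))).1.[1].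

Lemma eval1_laurentE f p n :
  val f = tofrac p / tofrac 'X ^+ n -> eval1 f = p.[1].
Proof.
rewrite /eval1; case: cid => -[p' n'] /= -> /eqP.
rewrite eqr_div ?tofracXn_neq0 // -!rmorphXn /= -!rmorphM /= tofrac_eq.
by move=> /eqP/(congr1 (horner^~ 1)); rewrite !hornerE !expr1n !mulr1.
Qed.

Lemma eval1_poly p : eval1 (laurent_poly p) = p.[1].
Proof. by apply: (@eval1_laurentE _ _ 0%N); rewrite expr0 divr1. Qed.

Lemma eval1_is_zmod_morphism : zmod_morphism eval1.
Proof.
move=> f g; have [[p n] /= fE] := laurentP f; have [[p' n'] /= gE] := laurentP g.
rewrite (eval1_laurentE fE) (eval1_laurentE gE).
rewrite (@eval1_laurentE _ (p * 'X^n' - p' * 'X^n) (n + n')%N).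
  by rewrite !hornerE !expr1n !mulr1.
rewrite rmorphB /= fE gE.
rewrite -mulNr addf_div ?tofracXn_neq0 // rmorphB !rmorphM /= !rmorphXn /=.
by rewrite mulNr exprD.
Qed.
HB.instance Definition _ :=
  GRing.isZmodMorphism.Build laurent F eval1 eval1_is_zmod_morphism.

Lemma eval1_is_monoid_morphism : monoid_morphism eval1.
Proof.
split=> [|f g].
  by rewrite -(rmorph1 laurent_poly) eval1_poly hornerE.
have [[p n] /= fE] := laurentP f; have [[p' n'] /= gE] := laurentP g.
rewrite (eval1_laurentE fE) (eval1_laurentE gE) -hornerM.
apply: (@eval1_laurentE _ _ (n + n')%N).
by rewrite rmorphM /= fE gE rmorphM mulf_div exprD.
Qed.
HB.instance Definition _ :=
  GRing.isMonoidMorphism.Build laurent F eval1 eval1_is_monoid_morphism.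

Lemma eval1T : eval1 laurentT = 1.
Proof. by rewrite eval1_poly hornerX. Qed.

Lemma eval1_eq0 f : (eval1 f == 0) <-> exists g, f = (laurentT - 1) * g.
Proof.
split=> [|[g ->]]; last by rewrite rmorphM rmorphB rmorph1 /= eval1T subrr mul0r.
have [p [n ->]] := laurentE f.
have -> : eval1 (laurent_poly p * laurentV ^+ n) = p.[1].
  apply: (@eval1_laurentE _ _ n).
  by rewrite rmorphM rmorphXn /= exprVn.
move=> /factor_theorem[r ->]; exists (laurent_poly r * laurentV ^+ n).
by rewrite rmorphM rmorphB /= polyC1 rmorph1 [_ r * _]mulrC mulrA.
Qed.

End Laurent.

Section Specialization.
Variable F : fieldType.

Local Notation free2 K := {malg K[{fmonom 'I_2}]}.

Definition weyl := qweyl (1 : F).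
HB.instance Definition _ := GRing.Algebra.on weyl.

Definition weylt := qweyl (laurentT F).
HB.instance Definition _ := GRing.Algebra.on weylt.

Lemma weyl_relE : qweyl_rel (1 : F) = fd F * fx F - fx F * fd F - 1.
Proof. by rewrite /qweyl_rel scale1r. Qed.

Lemma weylE : qd (1 : F) * qx 1 - qx 1 * qd 1 = 1.
Proof. by rewrite qweylE scale1r addrAC subrr add0r. Qed.

Definition free2_word (m : {fmonom 'I_2}) : free2 F := << m >>.
Lemma free2_word_mmorphism : mmorphism free2_word.
Proof.
by split=> // m m'; rewrite /free2_word malgM_def fgmulUU mul1r.
Qed.
HB.instance Definition _ :=
  isMultiplicative.Build {fmonom 'I_2} (free2 F) free2_word free2_word_mmorphism.

Definition free2_eval1 : free2 (laurent F) -> free2 F :=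
  locked (mmap (@malgC {fmonom 'I_2} F \o @eval1 F) free2_word).

Lemma free2_eval1_is_zmod_morphism : zmod_morphism free2_eval1.
Proof. by rewrite /free2_eval1 -lock; exact: raddfB. Qed.
HB.instance Definition _ := GRing.isZmodMorphism.Build (free2 (laurent F))
  (free2 F) free2_eval1 free2_eval1_is_zmod_morphism.

Lemma malgC_commr (a : F) (u : free2 F) : GRing.comm (a%:MP) u.
Proof.
by rewrite /GRing.comm mul_malgC -[u in LHS]mulr1 malg_fmonom_scaleAr -mul_malgC mulr1.
Qed.

Lemma free2_eval1_is_monoid_morphism : monoid_morphism free2_eval1.
Proof.
have [hM h1] := @commr_mmap_is_multiplicative {fmonom 'I_2} (laurent F) (free2 F)
  (@malgC {fmonom 'I_2} F \o @eval1 F) free2_word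
  (fun g m m' => @malgC_commr (eval1 (g@_m)) (free2_word m')).
by rewrite /free2_eval1 -lock; split.
Qed.
HB.instance Definition _ := GRing.isMonoidMorphism.Build (free2 (laurent F))
  (free2 F) free2_eval1 free2_eval1_is_monoid_morphism.

Lemma malgC_word (a : F) m : a%:MP * free2_word m = << a *g m >>.
Proof. by rewrite malgM_def fgmulUU mul1m mulr1. Qed.

Lemma free2_eval1U c m : free2_eval1 << c *g m >> = << eval1 c *g m >>.
Proof. by rewrite /free2_eval1 -lock mmapU malgC_word. Qed.

Lemma free2_eval1E u :
  free2_eval1 u = \sum_(m <- msupp u) << eval1 u@_m *g m >>.
Proof. by rewrite /free2_eval1 -lock; apply: eq_bigr => m _; rewrite malgC_word. Qed.

Lemma free2_eval1_coeff u m : (free2_eval1 u)@_m = eval1 (u@_m).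
Proof.
rewrite free2_eval1E [in RHS](monalgE u) !raddf_sum /=.
by apply: eq_bigr => k _; rewrite !mcoeffU raddfMn.
Qed.

Lemma free2_eval1Z c u : free2_eval1 (c *: u) = eval1 c *: free2_eval1 u.
Proof.
by rewrite /free2_eval1 -lock mmapZ mul_malgC.
Qed.

Lemma free2_eval1B u v :
  free2_eval1 (u - v) = free2_eval1 u - free2_eval1 v.
Proof. exact: rmorphB. Qed.
Lemma free2_eval1M u v :
  free2_eval1 (u * v) = free2_eval1 u * free2_eval1 v.
Proof. exact: rmorphM. Qed.
Lemma free2_eval1_1 : free2_eval1 1 = 1.
Proof. exact: rmorph1. Qed.

Lemma free2_eval1_rel :
  free2_eval1 (qweyl_rel (laurentT F)) = qweyl_rel (1 : F).
Proof.
have [ex ed] : free2_eval1 (fx _) = fx _ /\ free2_eval1 (fd _) = fd _.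
  by split; rewrite [LHS]free2_eval1U rmorph1.
rewrite /qweyl_rel free2_eval1B [X in X - _]free2_eval1B.
rewrite free2_eval1M free2_eval1Z eval1T.
by rewrite free2_eval1M ex ed free2_eval1_1.
Qed.

Lemma free2_eval1_surj v : exists u, free2_eval1 u = v.
Proof.
exists (\sum_(m <- msupp v) << laurent_poly (v@_m)%:P *g m >>).
rewrite raddf_sum [RHS]monalgE; apply: eq_bigr => m _.
by rewrite /= free2_eval1U eval1_poly hornerC.
Qed.

Lemma free2_eval1_eq0 u :
  free2_eval1 u = 0 -> exists v, u = (laurentT F - 1) *: v.
Proof.
move=> u0; have cP m : exists c, u@_m = (laurentT F - 1) * c.
  by apply/eval1_eq0; rewrite -free2_eval1_coeff u0 mcoeff0.
exists (\sum_(m <- msupp u) << projT1 (cid (cP m)) *g m >>).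
rewrite [u in LHS]monalgE scaler_sumr; apply: eq_bigr => m _.
case: cid => c /= ->; apply/malgP => k.
by rewrite mcoeffZ !mcoeffU mulrnAr.
Qed.

Lemma free2_eval1_tsideal u : u \in tsideal (qweyl_rel (laurentT F)) ->
  free2_eval1 u \in tsideal (qweyl_rel (1 : F)).
Proof.
move=> /tsidealP[s ->]; apply/tsidealP.
exists [seq (free2_eval1 p.1, free2_eval1 p.2) | p <- s].
rewrite raddf_sum big_map; apply: eq_bigr => p _ /=.
by rewrite !rmorphM /= free2_eval1_rel.
Qed.

(* The reduction weylt -> weyl modulo t - 1, sending x to x, d to d and t to 1;
   it is surjective with kernel (t - 1), by weyl_red_surj and weyl_red_eq0. *)
Definition weyl_red : weylt -> weyl :=
  lift_fun1 weylt (qweyl_pi 1 \o free2_eval1).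

Lemma weyl_red_pi u :
  weyl_red (qweyl_pi (laurentT F) u) = qweyl_pi 1 (free2_eval1 u).
Proof.
rewrite /weyl_red -lock /=; apply/eqP; rewrite qweyl_pi_eq -free2_eval1B free2_eval1_tsideal //.
by rewrite -qweyl_pi_eq qweyl_pi_repr.
Qed.

Lemma weyl_red_is_zmod_morphism : zmod_morphism weyl_red.
Proof.
move=> u v; rewrite -[u]qweyl_pi_repr -[v]qweyl_pi_repr.
move: (repr u) (repr v) => {}u {}v.
rewrite -[X in weyl_red X](qweyl_piB (laurentT F) u v).
rewrite weyl_red_pi (weyl_red_pi u) (weyl_red_pi v).
rewrite free2_eval1B; exact: qweyl_piB.
Qed.
HB.instance Definition _ :=
  GRing.isZmodMorphism.Build weylt weyl weyl_red weyl_red_is_zmod_morphism.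
Lemma weyl_red_is_monoid_morphism : monoid_morphism weyl_red.
Proof.
split=> [|u v].
  by rewrite -[X in weyl_red X](qweyl_pi1 (laurentT F)) weyl_red_pi free2_eval1_1 qweyl_pi1.
rewrite -[u]qweyl_pi_repr -[v]qweyl_pi_repr.
move: (repr u) (repr v) => {}u {}v.
rewrite -[X in weyl_red X](qweyl_piM (laurentT F) u v).
rewrite weyl_red_pi (weyl_red_pi u) (weyl_red_pi v).
rewrite free2_eval1M; exact: qweyl_piM.
Qed.
HB.instance Definition _ :=
  GRing.isMonoidMorphism.Build weylt weyl weyl_red weyl_red_is_monoid_morphism.

Lemma weyl_redx : weyl_red (qx (laurentT F)) = qx 1.
Proof. by rewrite weyl_red_pi free2_eval1U rmorph1. Qed.
Lemma weyl_redd : weyl_red (qd (laurentT F)) = qd 1.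
Proof. by rewrite weyl_red_pi free2_eval1U rmorph1. Qed.
Lemma weyl_redZ c u : weyl_red (c *: u) = eval1 c *: weyl_red u.
Proof.
rewrite -[u]qweyl_pi_repr; move: (repr u) => {}u.
by rewrite -qweyl_piZE 2!weyl_red_pi free2_eval1Z qweyl_piZE.
Qed.

Lemma weyl_red_surj (v : weyl) : exists u, weyl_red u = v.
Proof.
have [u uE] := free2_eval1_surj (repr v).
by exists (qweyl_pi _ u); rewrite weyl_red_pi uE qweyl_pi_repr.
Qed.

Lemma weyl_redB u v : weyl_red (u - v) = weyl_red u - weyl_red v.
Proof. exact: rmorphB. Qed.
Lemma weyl_redM u v : weyl_red (u * v) = weyl_red u * weyl_red v.
Proof. exact: rmorphM. Qed.
Lemma weyl_red1 : weyl_red 1 = 1.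
Proof. exact: rmorph1. Qed.

Lemma weyl_red_eq0 (u : weylt) :
  weyl_red u = 0 <-> u \in tsideal ((laurentT F - 1)%:A : weylt).
Proof.
split=> [|/tsidealP[s ->]]; last first.
  rewrite (raddf_sum weyl_red) big1 // => p _ /=.
  rewrite 2!weyl_redM weyl_redZ (rmorphB (@eval1 F)) rmorph1 /= eval1T subrr.
  by rewrite scale0r mulr0 mul0r.
rewrite -[u]qweyl_pi_repr weyl_red_pi -[RHS]qweyl_pi0; move: (repr u) => {}u.
move=> /eqP; rewrite qweyl_pi_eq subr0 => /tsidealP[s sE].
pose sec v := projT1 (cid (free2_eval1_surj v)).
have secK v : free2_eval1 (sec v) = v by rewrite /sec; case: cid.
pose w := \sum_(p <- s) sec p.1 * qweyl_rel (laurentT F) * sec p.2.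
have wE : free2_eval1 w = free2_eval1 u.
  rewrite sE /w (raddf_sum free2_eval1); apply: eq_bigr => p _ /=.
  by rewrite 2!free2_eval1M !secK free2_eval1_rel.
have w0 : qweyl_pi (laurentT F) w = 0.
  rewrite -[RHS]qweyl_pi0; apply/eqP; rewrite qweyl_pi_eq subr0.
  by apply/tsidealP; exists [seq (sec p.1, sec p.2) | p <- s]; rewrite big_map.
have [|v vE] := @free2_eval1_eq0 (u - w).
  by rewrite free2_eval1B wE subrr.
have -> : qweyl_pi (laurentT F) u = (laurentT F - 1)%:A * qweyl_pi _ v.
  by rewrite -scalerAl mul1r -qweyl_piZE -vE qweyl_piB w0 subr0.
exact/tsidealMr/tsideal_gen.
Qed.

(* The endomorphism induced by psi on weylt / (t - 1) = weyl; it does not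
   depend on the choice of preimages, by endo_redE. *)
Section EndoRed.
Variable psi : {lrmorphism weylt -> weylt}.

Definition endo_red (v : weyl) : weyl :=
  weyl_red (psi (projT1 (cid (weyl_red_surj v)))).

Lemma endo_redE u : endo_red (weyl_red u) = weyl_red (psi u).
Proof.
rewrite /endo_red; case: cid => u' /= uE; apply/eqP.
rewrite -subr_eq0 -weyl_redB -(rmorphB psi); apply/eqP/weyl_red_eq0.
have /weyl_red_eq0/tsidealP[s ->] : weyl_red (u' - u) = 0.
  by rewrite weyl_redB uE subrr.
rewrite (raddf_sum psi); apply: rpred_sum => p _ /=.
rewrite 2!(rmorphM psi) /= linearZ (rmorph1 psi).
exact/tsidealMr/tsidealMl/tsideal_gen.
Qed.

Lemma endo_red_is_zmod_morphism : zmod_morphism endo_red.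
Proof.
move=> v v'; have [[u <-] [u' <-]] := (weyl_red_surj v, weyl_red_surj v').
by rewrite -weyl_redB 3!endo_redE (rmorphB psi) weyl_redB.
Qed.
HB.instance Definition _ :=
  GRing.isZmodMorphism.Build weyl weyl endo_red endo_red_is_zmod_morphism.

Lemma endo_red_is_monoid_morphism : monoid_morphism endo_red.
Proof.
split=> [|v v']; first by rewrite -[in LHS]weyl_red1 endo_redE (rmorph1 psi) weyl_red1.
have [[u <-] [u' <-]] := (weyl_red_surj v, weyl_red_surj v').
by rewrite -weyl_redM 3!endo_redE (rmorphM psi) weyl_redM.
Qed.
HB.instance Definition _ :=
  GRing.isMonoidMorphism.Build weyl weyl endo_red endo_red_is_monoid_morphism.

Lemma endo_red_is_scalable : scalable endo_red.
Proof.
move=> c v; have [u <-] := weyl_red_surj v.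
have -> : c = eval1 (laurent_poly c%:P) by rewrite eval1_poly hornerC.
by rewrite -weyl_redZ 2!endo_redE linearZ weyl_redZ.
Qed.
HB.instance Definition _ :=
  GRing.isScalable.Build F weyl weyl *:%R endo_red endo_red_is_scalable.

End EndoRed.
End Specialization.

(* Main.v *)
Require Import Defs.
From HB Require Import structures.
From mathcomp Require Import all_boot all_order all_algebra.
From mathcomp Require Import finmap.
From mathcomp.multinomials Require Import monalg.
From mathcomp Require Import boolp reals complex.
From mathcomp Require Import zify ring.

Set Implicit Arguments.
Unset Strict Implicit.
Unset Printing Implicit Defensive.

Import GRing.Theory.
Local Open Scope ring_scope.

(* The element z = d x - x d of the quantum Weyl algebra satisfies z x = t x z
   and d z = t z d, and z = 1 at t = 1.  Hence (x, d + f(x)) and (x + f(d), d)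
   lift to (x, d + f(x) z) and (x + z f(d), d), and it suffices to prove
   Dixmier's theorem that such maps and scalings generate Aut(A_1).

   Let phi be an automorphism and a, b the orders in d of phi(x), phi(d), with
   leading coefficients f, g.  If a, b > 0, then [phi(d), phi(x)] = 1 gives
   b g f' = a f g', so f^b and g^a are proportional; if a | b or b | a, an
   elementary automorphism lowers a + b.  Otherwise take P with phi(P) = x: ad P
   is locally nilpotent, hence so is {p, _} on F[x, y], where p is the leading
   form of P for the weights (a, b).  As phi(P) has order 0, p is not a
   monomial, and no such p exists when neither weight divides the other. *)

(** * Locally nilpotent derivations *)

Section Derivations.
Variables (A : idomainType) (D : {additive A -> A}).
Hypothesis natA : forall n : nat, n.+1%:R != 0 :> A.
Hypothesis DM : forall u v, D (u * v) = D u * v + u * D v.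

Lemma iterD_eq0 m n u : (m <= n)%N -> iter m D u = 0 -> iter n D u = 0.
Proof.
move=> /subnK <- u0; rewrite iterD u0.
by elim: (n - m)%N => //= k ->; rewrite raddf0.
Qed.

Lemma iter_derivD n u v : iter n D (u + v) = iter n D u + iter n D v.
Proof. by elim: n => //= n ->; rewrite raddfD. Qed.

(** In the Leibniz expansion of D^(m+n)(uv), every term but one contains D^i u with i > m or D^j v
    with j > n. Induction on m + n with Pascal's rule replaces the full expansion. *)
Lemma iter_derivM m n u v : iter m.+1 D u = 0 -> iter n.+1 D v = 0 ->
  iter (m + n) D (u * v) = (iter m D u * iter n D v) *+ 'C(m + n, m).
Proof.
have [k] := ubnP (m + n)%N; elim: k => // k IH in m n u v *.
case: m n => [|m] [|n] lek u0 v0.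
- by rewrite bin0 mulr1n.
- rewrite bin0 mulr1n (iterSr _ D (u * v)) DM [D u]u0 mul0r add0r.
  by have := IH 0 n u (D v); rewrite !add0n !bin0 !mulr1n -!iterSr => ->.
- have := IH m 0 (D u) v; rewrite !addn0 !binn !mulr1n -!iterSr => IHm.
  by rewrite (iterSr _ D (u * v)) DM [D v]v0 mulr0 addr0 IHm // -ltnS -[m.+1]addn0.
rewrite addSn iterSr DM iter_derivD.
rewrite (IH m n.+1) -?iterSr //.
rewrite addnS -addSn (IH m.+1 n) -?iterSr //; last by rewrite addSnnS.
rewrite -mulrnDr; congr (_ *+ _).
by rewrite [in RHS]addSnnS binS addSnnS addnC.
Qed.

Lemma iter_derivM_eq0 m n u v : iter m.+1 D u = 0 -> iter n.+1 D v = 0 ->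
  iter (m + n).+1 D (u * v) = 0.
Proof.
move=> u0 v0; rewrite iterS iter_derivM // raddfMn DM -!iterS u0 v0.
by rewrite mul0r mulr0 addr0 mul0rn.
Qed.

Hypothesis Dnil : forall u, exists n, iter n D u = 0.

(** This n serves as the degree of u with respect to D: it is additive on products and drops by one
    under D. *)
Lemma deriv_degree u : u != 0 -> exists2 n, iter n D u != 0 & iter n.+1 D u = 0.
Proof.
move=> u0; have exD : exists n, iter n D u == 0 by have [n /eqP] := Dnil u; exists n.
case: (ex_minnP exD) => -[|n] /eqP nE nmin; first by case/eqP: u0.
by exists n => //; apply/negP => /nmin; rewrite ltnn.
Qed.

(** The surviving Leibniz term is a nonzero integer times a product of nonzero elements of a domain,
    so degrees add. *)
Lemma iter_derivM_neq0 m n u v : iter m D u != 0 -> iter m.+1 D u = 0 ->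
  iter n D v != 0 -> iter n.+1 D v = 0 -> iter (m + n) D (u * v) != 0.
Proof.
move=> um u0 vn v0; rewrite iter_derivM // -mulr_natr !mulf_neq0 //.
have : (0 < 'C(m + n, m))%N by rewrite bin_gt0 leq_addr.
by case: 'C(_, _) => // k _; apply: natA.
Qed.

(** A nonzero element of the kernel has degree 0; since degrees add, its factors have degree 0 as
    well. *)
Lemma deriv_ker_factorially_closed u v : v != 0 -> D (u * v) = 0 -> D u = 0.
Proof.
have [->|u0] := eqVneq u 0; first by rewrite raddf0.
move=> v0 Duv; have [m um um0] := deriv_degree u0.
have [n vn vn0] := deriv_degree v0.
have := iter_derivM_neq0 um um0 vn vn0; case: m um um0 => [//|m] um um0.
by rewrite addSn iterSr Duv (iterD_eq0 (leq0n _)) ?eqxx.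
Qed.

(** D lowers the degree of x by one, while [D x] has at least the degree of its factor y. *)
Lemma deriv_degree_lt x y r m n : D x = y * r -> D x != 0 ->
  iter m.+1 D x = 0 -> iter n D y != 0 -> iter n.+1 D y = 0 -> (n < m)%N.
Proof.
move=> Dx Dx0 xm yn yn0; have r0 : r != 0.
  by apply: contraNneq Dx0 => r0; rewrite Dx r0 mulr0.
have [k rk rk0] := deriv_degree r0.
have := iter_derivM_neq0 yn yn0 rk rk0; rewrite -Dx -iterSr.
by rewrite ltnNge; apply: contraNN => le_mn; apply/eqP/(iterD_eq0 _ xm); lia.
Qed.

(** If both derivatives were nonzero, each of x and y would have degree strictly smaller than the
    other. *)
Lemma deriv_cross_divides x y r s : D x = y * r -> D y = x * s ->
  D x = 0 \/ D y = 0.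
Proof.
move=> Dx Dy; have [->|Dx0] := eqVneq (D x) 0; first by left.
have [->|Dy0] := eqVneq (D y) 0; first by right.
have x0 : x != 0 by apply: contraNneq Dx0 => ->; rewrite raddf0.
have y0 : y != 0 by apply: contraNneq Dy0 => ->; rewrite raddf0.
have [m xm xm0] := deriv_degree x0; have [n yn yn0] := deriv_degree y0.
have := deriv_degree_lt Dx Dx0 xm0 yn yn0.
have := deriv_degree_lt Dy Dy0 yn0 xm xm0; lia.
Qed.

End Derivations.

(** * Leading coefficients and Wronskians of polynomials in one variable *)

Section PolyFacts.

Lemma coefM_top (A : nzRingType) (p q : {poly A}) m n :
  (size p <= m.+1)%N -> (size q <= n.+1)%N -> (p * q)`_(m + n) = p`_m * q`_n.
Proof.
move=> pm qn; rewrite coefM (bigD1 (Ordinal (leq_addr n m : (m < (m + n).+1)%N))) //=.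
rewrite addKn big1 ?addr0 // => -[i ltin] /= /eqP ne.
have {}ne : i <> m by move=> ei; apply: ne; apply: val_inj.
have [lt_im|le_mi] := ltnP i m.
  by rewrite [q`__]nth_default ?mulr0 // (leq_trans qn) //; lia.
by rewrite [p`__]nth_default ?mul0r // (leq_trans pm) //; lia.
Qed.

Variable F : numFieldType.
Implicit Types u v : {poly F}.

(** For degrees m and n, the coefficients at m + n - 1 of the two sides are m and n times the
    product of the leading coefficients; characteristic 0 gives m = n. *)
Lemma wronskian_size u v : u != 0 -> v != 0 -> u^`() * v = u * v^`() ->
  size u = size v.
Proof.
move=> u0 v0 W; have [[m um] [n vn]] : (exists m, size u = m.+1) /\ (exists n, size v = n.+1).
  by split; [exists (size u).-1; exact: polySpred | exists (size v).-1; exact: polySpred].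
have luv : u`_m * v`_n != 0.
  have -> : u`_m = lead_coef u by rewrite /lead_coef um.
  have -> : v`_n = lead_coef v by rewrite /lead_coef vn.
  by rewrite mulf_neq0 // lead_coef_eq0.
suff mn : m = n by rewrite um vn mn.
have [k kE] : exists k, (m + n)%N = k by exists (m + n)%N.
case: k kE => [|k] kE; first by lia.
have dsz (w : {poly F}) l : size w = l.+1 -> (size w^`() <= l)%N.
  by move=> szw; rewrite -ltnS -szw lt_size_deriv // -size_poly_gt0 szw.
have EL : (u^`() * v)`_k = (u`_m * v`_n) *+ m.
  case: m um kE {luv} => [|m] um kE.
    have /size_poly_leq0P -> := dsz _ _ um; by rewrite mul0r coef0 mulr0n.
  by rewrite (_ : k = (m + n)%N) ?coefM_top ?dsz ?vn ?coef_deriv ?mulrnAl //; lia.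
have ER : (u * v^`())`_k = (u`_m * v`_n) *+ n.
  case: n vn kE {luv EL} => [|n] vn kE.
    have /size_poly_leq0P -> := dsz _ _ vn; by rewrite mulr0 coef0 mulr0n.
  by rewrite (_ : k = (m + n)%N) ?coefM_top ?dsz ?um ?coef_deriv ?mulrnAr //; lia.
move: EL; rewrite W ER => /eqP; rewrite -!(mulr_natr (_ * _)).
by rewrite (inj_eq (mulfI luv)) Num.Theory.eqr_nat => /eqP.
Qed.

(** Subtracting the multiple of v that kills the coefficient of u at the degree of v preserves the
    relation. A nonzero remainder would have the size of v by [wronskian_size], yet its coefficient
    there is 0. *)
Lemma wronskian_eq0 u v : v != 0 -> u^`() * v = u * v^`() -> exists c, u = c *: v.
Proof.
move=> v0 W; pose c := u`_(size v).-1 / lead_coef v.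
exists c; apply/eqP; rewrite -subr_eq0; apply: contraT => r0.
have Wr : (u - c *: v)^`() * v = (u - c *: v) * v^`().
  by rewrite derivB derivZ !mulrBl W -!scalerAl [v * _]mulrC.
have := wronskian_size r0 v0 Wr => sz.
have : lead_coef (u - c *: v) = 0.
  rewrite /lead_coef sz coefB coefZ -/(lead_coef v) divfK ?subrr //.
  by rewrite lead_coef_eq0.
by move/eqP; rewrite lead_coef_eq0 (negPf r0).
Qed.

End PolyFacts.

(** * The Poisson bracket *)

Section Poisson.
Variable F : numFieldType.
Local Notation B := {poly {poly F}}.
Implicit Types U V P : B.

(** The inner variable of [B] plays the role of x and the outer one that of d, so this is the
    partial derivative in x, and [deriv] on [B] is the one in d. *)
Definition dX U : B := map_poly (@deriv F) U.

Lemma coef_dX U j : (dX U)`_j = (U`_j)^`().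
Proof. by rewrite coef_map. Qed.

Lemma dX_is_zmod_morphism : zmod_morphism dX.
Proof. by move=> U V; apply/polyP => j; rewrite !(coef_dX, coefB) derivB. Qed.
HB.instance Definition _ := GRing.isZmodMorphism.Build B B dX dX_is_zmod_morphism.

Lemma dXM U V : dX (U * V) = dX U * V + U * dX V.
Proof.
apply/polyP => j; rewrite coefD coef_dX !coefM linear_sum -big_split /=.
by apply: eq_bigr => i _; rewrite !coef_dX derivM.
Qed.

Lemma dXC c : dX c%:P = (c^`())%:P.
Proof. by rewrite /dX map_polyC. Qed.

Lemma dXX : dX 'X = 0.
Proof. by apply/polyP => j; rewrite coef_dX coefX coef0 -polyC_natr derivC. Qed.

Lemma dX_eq0 U i j : dX U = 0 -> U`_j`_i != 0 -> i = 0%N.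
Proof.
move=> U0; case: i => // i; have := congr1 (fun V : B => V`_j`_i) U0.
rewrite coef_dX coef_deriv !coef0 => /eqP.
by rewrite -mulr_natr mulf_eq0 Num.Theory.pnatr_eq0 orbF => ->.
Qed.

Lemma deriv_eq0 U i j : U^`() = 0 -> U`_j`_i != 0 -> j = 0%N.
Proof.
move=> U0; case: j => // j; have := congr1 (fun V : B => V`_j`_i) U0.
rewrite coef_deriv !coef0 coefMn => /eqP.
by rewrite -mulr_natr mulf_eq0 Num.Theory.pnatr_eq0 orbF => ->.
Qed.

(** The sign is such that {d, x} = 1, matching the commutator [d, x] = 1. *)
Definition pb P U : B := P^`() * dX U - dX P * U^`().

Lemma pb_is_zmod_morphism P : zmod_morphism (pb P).
Proof. by move=> U V; rewrite /pb (raddfB dX) derivB !mulrBr; ring. Qed.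
HB.instance Definition _ P :=
  GRing.isZmodMorphism.Build B B (pb P) (pb_is_zmod_morphism P).

Lemma pbBl P Q U : pb (P - Q) U = pb P U - pb Q U.
Proof. by rewrite /pb (raddfB dX) derivB !mulrBl; ring. Qed.

Lemma pbM P U V : pb P (U * V) = pb P U * V + U * pb P V.
Proof. by rewrite /pb dXM derivM; ring. Qed.

Lemma pbb P : pb P P = 0.
Proof. by rewrite /pb mulrC subrr. Qed.

Lemma pbC P (c : F) : pb P c%:P%:P = 0.
Proof. by rewrite /pb dXC !derivC mulr0 mulr0 subrr. Qed.

Lemma pbX P : pb P 'X = - dX P.
Proof. by rewrite /pb dXX derivX mulr0 mulr1 sub0r. Qed.

Lemma pbXP P : pb P 'X%:P = P^`().
Proof. by rewrite /pb dXC derivX derivC mulr0 subr0 mulr1. Qed.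

Lemma natB_neq0 n : n.+1%:R != 0 :> B.
Proof. by rewrite -!polyC_natr !polyC_eq0 Num.Theory.pnatr_eq0. Qed.

(** By the Leibniz rule, the elements killed by some power of a derivation form a subring; here it
    contains F and both variables. *)
Lemma pb_nilpotent P m n : iter m (pb P) 'X%:P = 0 -> iter n (pb P) 'X = 0 ->
  forall U, exists k, iter k (pb P) U = 0.
Proof.
move=> Xm Yn; have le0 := @iterD_eq0 _ (pb P).
have nilD U V : (exists k, iter k (pb P) U = 0) -> (exists k, iter k (pb P) V = 0) ->
    exists k, iter k (pb P) (U + V) = 0.
  move=> [k Uk] [l Vl]; exists (k + l)%N.
  by rewrite iter_derivD (le0 _ _ _ _ Uk) ?(le0 _ _ _ _ Vl) ?leq_addr ?leq_addl ?addr0.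
have nilM U V : (exists k, iter k (pb P) U = 0) -> (exists k, iter k (pb P) V = 0) ->
    exists k, iter k (pb P) (U * V) = 0.
  move=> [k Uk] [l Vl]; exists (k + l).+1.
  apply: (iter_derivM_eq0 (@pbM P)).
    exact: le0 Uk.
  exact: le0 Vl.
elim/poly_ind => [|U c nilU]; first by exists 0%N.
apply: (nilD); first by apply: (nilM) => //; exists n.
elim/poly_ind: c {nilU} => [|c e nilc]; first by exists 0%N.
rewrite polyCD polyCM; apply: nilD; first by apply: nilM => //; exists m.
by exists 1%N; rewrite /= pbC.
Qed.

Lemma divX_coef U : U`_0 = 0 -> exists V, U = 'X * V.
Proof.
move=> U0; exists (\poly_(j < size U) U`_j.+1); apply/polyP => j.
rewrite coefXM; case: j => [|j] /=; first by rewrite U0.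
rewrite coef_poly; case: ltnP => // szU.
by rewrite nth_default // (leq_trans szU).
Qed.

Lemma divXP_coef U : (forall j, U`_j`_0 = 0) -> exists V, U = 'X%:P * V.
Proof.
move=> U0; exists (\poly_(j < size U) \poly_(i < size U`_j) U`_j`_i.+1).
apply/polyP => j; rewrite coefCM coef_poly.
case: ltnP => [_|szU]; last by rewrite mulr0 nth_default.
apply/polyP => i; rewrite coefXM; case: i => [|i] /=; first by rewrite U0.
by rewrite coef_poly; case: ltnP => // /leqW szU; rewrite nth_default.
Qed.

(* The terms of P include x^m and d^l, otherwise the kernel of {P, _} would
   contain x or d; non-divisibility of the weights then forces d | dP/dd and
   x | dP/dx, which no locally nilpotent derivation tolerates. *)
Lemma no_lnd_quasihomogeneous a b n P : (0 < a)%N -> (0 < b)%N ->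
  ~~ (a %| b)%N -> ~~ (b %| a)%N ->
  (forall i j, P`_j`_i != 0 -> (a * i + b * j = n)%N) ->
  (exists i j, P`_j`_i != 0) ->
  (forall i0 j0, P`_j0`_i0 != 0 ->
     exists i j, P`_j`_i != 0 /\ ((i != i0) || (j != j0))) ->
  forall k l, iter k (pb P) 'X%:P = 0 -> iter l (pb P) 'X = 0 -> False.
Proof.
move=> a0 b0 ab ba hom [i0 [j0 P0]] nmono k l Xk Yl.
have Pnz : P != 0 by apply: contraNneq P0 => ->; rewrite !coef0.
have nil := pb_nilpotent Xk Yl.
(* If only d occurred in P, homogeneity would fix its exponent and P would be a monomial. *)
have dX0 : dX P = 0 -> False.
  move=> dP; have [i [j [Pij]]] := nmono _ _ P0.
  have := hom _ _ P0; have := hom _ _ Pij.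
  rewrite (dX_eq0 dP P0) (dX_eq0 dP Pij) !muln0 !add0n eqxx /= => <- /eqP.
  by rewrite eqn_pmul2l // eq_sym => ->.
have dY0 : P^`() = 0 -> False.
  move=> dP; have [i [j [Pij]]] := nmono _ _ P0.
  have := hom _ _ P0; have := hom _ _ Pij.
  rewrite (deriv_eq0 dP P0) (deriv_eq0 dP Pij) !muln0 !addn0 eqxx orbF => <- /eqP.
  by rewrite eqn_pmul2l // eq_sym => ->.
have natA := natB_neq0.
(* Without a pure power of x, d divides P. As P lies in the kernel of {P, _}, so does d, and {P, d}
   = -dP/dx vanishes. *)
have [i1 Pi1] : exists i, P`_0`_i != 0.
  apply: contrapT => noX; have [Q PE] : exists Q, P = 'X * Q.
    apply: divX_coef; apply/polyP => i; rewrite coef0.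
    by apply/eqP; apply: contraT => Pi; case: noX; exists i.
  have Q0 : Q != 0 by apply: contraNneq Pnz => Q0; rewrite PE Q0 mulr0.
  have := @deriv_ker_factorially_closed _ (pb P) natA (@pbM P) nil 'X Q Q0.
  by rewrite -PE /= pbb pbX => /(_ erefl)/eqP; rewrite oppr_eq0 => /eqP.
have [j1 Pj1] : exists j, P`_j`_0 != 0.
  apply: contrapT => noY; have [Q PE] : exists Q, P = 'X%:P * Q.
    by apply: divXP_coef => j; apply/eqP; apply: contraT => Pj; case: noY; exists j.
  have Q0 : Q != 0 by apply: contraNneq Pnz => Q0; rewrite PE Q0 mulr0.
  have := @deriv_ker_factorially_closed _ (pb P) natA (@pbM P) nil 'X%:P Q Q0.
  by rewrite -PE /= pbb pbXP => /(_ erefl).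
(* A term x^i d of P would have weight a i + b, equal to the weight a i1 of a pure power of x, so a
   would divide b. *)
have [R RE] : exists R, P^`() = 'X * R.
  apply: divX_coef; rewrite coef_deriv mulr1n; apply/polyP => i; rewrite coef0.
  apply/eqP; apply: contraT => /hom; have := hom _ _ Pi1.
  rewrite muln0 addn0 muln1 => <- E; case/negP: ab.
  by rewrite -(dvdn_addr _ (dvdn_mulr i (dvdnn a))) E dvdn_mulr.
have [S SE] : exists S, dX P = 'X%:P * S.
  apply: divXP_coef => j; rewrite coef_dX coef_deriv mulr1n.
  apply/eqP; apply: contraT => /hom; have := hom _ _ Pj1.
  rewrite muln0 add0n muln1 => <- E; case/negP: ba.
  by rewrite -(dvdn_addl _ (dvdn_mulr j (dvdnn b))) E dvdn_mulr.
(* {P, x} = dP/dd is a multiple of d, and {P, d} = -dP/dx is a multiple of x. *)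
have := @deriv_cross_divides _ (pb P) natA (@pbM P) nil 'X%:P 'X R (- S).
rewrite /= pbX pbXP mulrN SE RE => /(_ erefl erefl); rewrite -RE -SE => -[//|/eqP].
by rewrite oppr_eq0 => /eqP.
Qed.

End Poisson.

(** * Weights *)

Section WeightedSupport.
Variables (F : numFieldType) (a b : nat).
Local Notation B := {poly {poly F}}.
Implicit Types (U V P : B) (S T : nat -> Prop).

(** With a predicate on weights, homogeneity and weak or strict bounds share one calculus. A bound
    lowered by s is written [c + s <= m], which avoids truncated subtraction. *)
Definition wsupp S U := forall i j, U`_j`_i != 0 -> S (a * i + b * j)%N.

Lemma wsupp_mono S T U : (forall c, S c -> T c) -> wsupp S U -> wsupp T U.
Proof. by move=> ST SU i j /SU/ST. Qed.

Lemma wsupp0 S : wsupp S 0.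
Proof. by move=> i j; rewrite !coef0 eqxx. Qed.

Lemma wsuppN S U : wsupp S U -> wsupp S (- U).
Proof. by move=> SU i j; rewrite !coefN oppr_eq0 => /SU. Qed.

Lemma wsuppD S U V : wsupp S U -> wsupp S V -> wsupp S (U + V).
Proof.
move=> SU SV i j; rewrite !coefD; have [->|/SU//] := eqVneq U`_j`_i 0.
by rewrite add0r => /SV.
Qed.

Lemma wsuppB S U V : wsupp S U -> wsupp S V -> wsupp S (U - V).
Proof. by move=> SU SV; apply: wsuppD => //; apply: wsuppN. Qed.

Lemma wsupp_sum S (I : Type) (r : seq I) (P : pred I) (U : I -> B) :
  (forall i, P i -> wsupp S (U i)) -> wsupp S (\sum_(i <- r | P i) U i).
Proof. by move=> SU; elim/big_rec: _ => [|i V /SU]; [apply: wsupp0|apply: wsuppD]. Qed.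

Lemma wsuppM S T (R : nat -> Prop) U V :
  (forall c d, S c -> T d -> R (c + d)%N) -> wsupp S U -> wsupp T V -> wsupp R (U * V).
Proof.
move=> ST SU TV i j nz; apply: contrapT => nR; case/eqP: nz.
rewrite coefM coef_sum big1 // => -[k ltk] _; rewrite coefM big1 // => -[l ltl] _ /=.
apply/eqP; rewrite mulf_eq0; apply: contraT; rewrite negb_or => /andP[/SU Sk /TV Tl].
case: nR; have := ST _ _ Sk Tl; congr (R _).
rewrite addnACA -!mulnDr; congr (_ * _ + _ * _)%N; lia.
Qed.

Lemma wsupp_nderivn S U s : wsupp S U -> wsupp (fun c => S (c + b * s)%N) U^`N(s).
Proof.
move=> SU i j; rewrite coef_nderivn coefMn -mulr_natr mulf_eq0 negb_or => /andP[/SU + _].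
by rewrite mulnDr [(b * s + _)%N]addnC addnA.
Qed.

Lemma wsupp_deriv S U : wsupp S U -> wsupp (fun c => S (c + b)%N) U^`().
Proof. by move=> SU; have := wsupp_nderivn (s := 1) SU; rewrite nderivn1 muln1. Qed.

Lemma wsupp_dX S U : wsupp S U -> wsupp (fun c => S (c + a)%N) (dX U).
Proof.
move=> SU i j; rewrite coef_dX coef_deriv -mulr_natr mulf_eq0 negb_or => /andP[/SU + _].
by rewrite mulnS -addnA addnC.
Qed.

Lemma wsupp_iter_dX S U s : wsupp S U -> wsupp (fun c => S (c + a * s)%N) (iter s (@dX F) U).
Proof.
move=> SU; elim: s => [|s IH]; first by apply: wsupp_mono SU => c; rewrite muln0 addn0.
by apply: wsupp_mono (wsupp_dX IH) => c; rewrite mulnS addnA.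
Qed.

(* The product of the Weyl algebra read on symbols; the sum is complete, and
   the value independent of n, as soon as size U <= n. *)
Definition star n U V : B := \sum_(s < n) U^`N(s) * iter s (@dX F) V.

Lemma starDl n U V W : star n (U + V) W = star n U W + star n V W.
Proof. by rewrite -big_split; apply: eq_bigr => s _; rewrite nderivnD mulrDl. Qed.

Lemma wsupp_star_term x y m k s U V :
  wsupp (fun c => c + x <= m)%N U -> wsupp (fun c => c + y <= k)%N V ->
  wsupp (fun c => c + (x + y) + (a + b) * s <= m + k)%N (U^`N(s) * iter s (@dX F) V).
Proof.
move=> SU SV; apply: wsuppM (wsupp_nderivn (s := s) SU) (wsupp_iter_dX (s := s) SV).
by move=> c d /= cm dk; rewrite mulnDl; lia.
Qed.

(** The term s = 0 is the commutative product; each later one loses at least a + b, namely b per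
    derivative in d and a per derivative in x. *)
Lemma star_top x y m k n U V :
  wsupp (fun c => c + x <= m)%N U -> wsupp (fun c => c + y <= k)%N V ->
  wsupp (fun c => c + (x + y) + (a + b) <= m + k)%N (star n.+1 U V - U * V).
Proof.
move=> SU SV; rewrite /star big_ord_recl nderivn0 /= addrAC subrr add0r.
apply: wsupp_sum => s _; apply: wsupp_mono (wsupp_star_term (s := s.+1) SU SV).
by move=> c; apply: leq_trans; rewrite leq_add2l mulnS leq_addr.
Qed.

Lemma star_top2 x y m k n U V :
  wsupp (fun c => c + x <= m)%N U -> wsupp (fun c => c + y <= k)%N V ->
  wsupp (fun c => c + (x + y) + (a + b) * 2 <= m + k)%N
    (star n.+2 U V - U * V - U^`() * dX V).
Proof.
move=> SU SV; rewrite /star !big_ord_recl nderivn0 nderivn1 /=.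
rewrite [U * V + _]addrC addrK addrAC subrr add0r.
apply: wsupp_sum => s _; apply: wsupp_mono (wsupp_star_term (s := s.+2) SU SV).
by move=> c; apply: leq_trans; rewrite leq_add2l leq_mul2l; apply/orP; right.
Qed.

Lemma wsupp_pb S T (R : nat -> Prop) P U :
  (forall c d, S (c + a)%N -> T (d + b)%N -> R (c + d)%N) ->
  (forall c d, S (c + b)%N -> T (d + a)%N -> R (c + d)%N) ->
  wsupp S P -> wsupp T U -> wsupp R (pb P U).
Proof.
move=> R1 R2 SP TU; apply: wsuppB.
  exact: wsuppM R2 (wsupp_deriv SP) (wsupp_dX TU).
exact: wsuppM R1 (wsupp_dX SP) (wsupp_deriv TU).
Qed.

(** The commutative products cancel in the commutator, the terms s = 1 form {U, V}, and the rest
    lies 2 (a + b) lower. Replacing U and V by their top parts [P] and [V0] changes only lower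
    weights. The slack [x] records the weight lost in earlier commutators. *)
Lemma star_commutator_top n x m k U V P V0 :
  (0 < a + b)%N ->
  wsupp (fun c => c = m) P -> wsupp (fun c => c < m)%N (U - P) ->
  wsupp (fun c => c + x = k)%N V0 -> wsupp (fun c => c + x < k)%N (V - V0) ->
  wsupp (fun c => c + (x + (a + b)) = k + m)%N (pb P V0) /\
  wsupp (fun c => c + (x + (a + b)) < k + m)%N
    (star n.+2 U V - star n.+2 V U - pb P V0).
Proof.
move=> ab0 SP SUP SV0 SVV; split.
  by apply: wsupp_pb SP SV0 => c d /=; lia.
have SU : wsupp (fun c => c + 0 <= m)%N U.
  rewrite -[U](subrK P); apply: wsuppD; [apply: wsupp_mono SUP | apply: wsupp_mono SP];
  by move=> c /=; lia.
have SV : wsupp (fun c => c + x <= k)%N V.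
  rewrite -[V](subrK V0); apply: wsuppD; [apply: wsupp_mono SVV | apply: wsupp_mono SV0];
  by move=> c /=; lia.
have UV := star_top2 (n := n) SU SV; have VU := star_top2 (n := n) SV SU.
have -> : star n.+2 U V - star n.+2 V U - pb P V0 =
    (star n.+2 U V - U * V - U^`() * dX V) - (star n.+2 V U - V * U - V^`() * dX U)
    + (pb (U - P) V + pb P (V - V0)).
  by rewrite pbBl (raddfB (pb P)) /= /pb; ring.
apply: wsuppD; first apply: wsuppB.
- by apply: wsupp_mono UV => c /=; lia.
- by apply: wsupp_mono VU => c /=; lia.
apply: wsuppD; first by apply: wsupp_pb SUP SV => c d /=; lia.
by apply: wsupp_pb SP SVV => c d /=; lia.
Qed.

Lemma exists_top U : U != 0 ->
  exists n P, [/\ wsupp (fun c => c = n) P, wsupp (fun c => c < n)%N (U - P) &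
   exists i j, P`_j`_i != 0].
Proof.
move=> U0; have Ule m : (exists i j, U`_j`_i != 0 /\ (m < a * i + b * j)%N) \/
    wsupp (fun c => c <= m)%N U.
  have [|nex] := pselect (exists i j, U`_j`_i != 0 /\ (m < a * i + b * j)%N); first by left.
  by right=> i j Uij; rewrite leqNgt; apply/negP => lt; case: nex; exists i, j.
have Uex : exists i j, U`_j`_i != 0.
  exists (size (lead_coef U)).-1, (size U).-1.
  by rewrite -/(lead_coef U) -/(lead_coef (lead_coef U)) !lead_coef_eq0.
suff [n [i [j [Uij En Sn]]]] : exists n i j,
    [/\ U`_j`_i != 0, (a * i + b * j = n)%N & wsupp (fun c => c <= n)%N U].
  pose P : B := \poly_(k < size U) \poly_(l < size U`_k)
     (if (a * l + b * k == n)%N then U`_k`_l else 0).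
  have PE k l : P`_l`_k = if (a * k + b * l == n)%N then U`_l`_k else 0.
    rewrite coef_poly; case: ltnP => szU.
      rewrite coef_poly; case: ltnP => // szUl.
      by rewrite (nth_default _ szUl) if_same.
    by rewrite (nth_default _ szU) !coef0 if_same.
  exists n, P; split=> //.
  - by move=> k l; rewrite PE; case: ifP => [/eqP //|_]; rewrite eqxx.
  - move=> k l; rewrite !coefB PE; case: ifP => [_|/eqP ne]; first by rewrite subrr eqxx.
    by rewrite subr0 => /Sn /=; rewrite leq_eqVlt => /orP[/eqP//|].
  - by exists i, j; rewrite PE En eqxx.
have bnd : exists m, wsupp (fun c => c <= m)%N U.
  pose m := (\max_(j < size U) \max_(i < size (U`_j)%R) (a * i + b * j))%N.
  exists m => i j Uij.
  have ltj : (j < size U)%N.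
    by rewrite ltnNge; apply: contraNN Uij => /(nth_default 0) ->; rewrite coef0.
  have lti : (i < size (U`_j)%R)%N.
    by rewrite ltnNge; apply: contraNN Uij => /(nth_default 0) ->.
  apply: leq_trans (leq_bigmax (F := fun j : 'I_(size U) =>
    \max_(i < size (U`_j)%R) (a * i + b * j))%N (Ordinal ltj)).
  exact: (leq_bigmax (F := fun i : 'I_(size (U`_j)%R) => (a * i + b * j))%N (Ordinal lti)).
(* The bound is lowered until it is attained: below m + 1, either some term has weight above m,
   hence exactly m + 1, or m is a bound too. *)
case: bnd; elim => [|m IH] Sm.
  have [i [j Uij]] := Uex; exists 0%N, i, j; split=> //.
  by have := Sm _ _ Uij; rewrite leqn0 => /eqP.
have [[i [j [Uij lt]]]|/IH//] := Ule m.
exists m.+1, i, j; split=> //.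
by apply/eqP; rewrite eqn_leq lt (Sm _ _ Uij).
Qed.

End WeightedSupport.

(** * Normal ordering *)

Section NormalOrder.
Variables (F : numFieldType) (W : algType F) (x d : W).
Hypothesis dx_rel : d * x = x * d + 1.
Local Notation B := {poly {poly F}}.
Local Notation dX := (@dX F).
Local Notation hx := (horner_alg x).
Implicit Types (U V : B) (c : {poly F}).

(* The element of W with symbol U: powers of x (inner variable) on the left of
   powers of d (outer variable). *)
Definition nord U : W := (map_poly hx U).[d].

Lemma nord_is_zmod_morphism : zmod_morphism nord.
Proof. by move=> U V; rewrite /nord rmorphB hornerD hornerN. Qed.
HB.instance Definition _ := GRing.isZmodMorphism.Build B W nord nord_is_zmod_morphism.

Lemma nordMX U : nord (U * 'X) = nord U * d.
Proof. by rewrite /nord rmorphM /= map_polyX hornerMX. Qed.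

Lemma nordCM c U : nord (c%:P * U) = hx c * nord U.
Proof. by rewrite /nord rmorphM /= map_polyC hornerCM. Qed.

Lemma nordC c : nord c%:P = hx c.
Proof. by rewrite /nord map_polyC hornerC. Qed.

Lemma nord1 : nord 1 = 1.
Proof. by rewrite -polyC1 nordC rmorph1. Qed.

Lemma nordX : nord 'X = d.
Proof. by rewrite -['X]mul1r nordMX nord1 mul1r. Qed.

Lemma nordXP : nord 'X%:P = x.
Proof. by rewrite nordC horner_algX. Qed.

Lemma nordCC (k : F) : nord k%:P%:P = k%:A.
Proof. by rewrite nordC horner_algC. Qed.

Lemma nordZ (k : F) U : nord (k%:P *: U) = k *: nord U.
Proof. by rewrite -mul_polyC nordCM horner_algC -scalerAl mul1r. Qed.

Lemma horner_algE c : hx c = \sum_(i < size c) c`_i *: x ^+ i.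
Proof.
rewrite -[c in LHS]coefK poly_def linear_sum; apply: eq_bigr => i _.
by rewrite linearZ rmorphXn /= horner_algX -scalerAl mul1r.
Qed.

Lemma nordE U :
  nord U = \sum_(j < size U) \sum_(i < size U`_j) U`_j`_i *: (x ^+ i * d ^+ j).
Proof.
rewrite /nord (@horner_coef_wide _ (size U)) ?size_poly //.
apply: eq_bigr => j _; rewrite coef_map /= horner_algE mulr_suml.
by apply: eq_bigr => i _; rewrite scalerAl.
Qed.

Lemma d_horner_alg c : d * hx c = hx c * d + hx c^`().
Proof.
elim/poly_ind: c => [|c k IH]; first by rewrite deriv0 !rmorph0 mulr0 mul0r addr0.
rewrite derivD derivC addr0 derivM derivX mulr1.
rewrite !rmorphD !rmorphM /= horner_algX horner_algC mulrDr mulrDl.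
rewrite mulrA IH mulrDl -[_ * d * x]mulrA dx_rel mulrDr mulr1 mulrA.
rewrite -scalerAr -scalerAl mulr1 mul1r.
by rewrite [LHS](ACl ((1*4)*(3*2))%AC).
Qed.

Lemma d_nord U : d * nord U = nord (U * 'X + dX U).
Proof.
elim/poly_ind: U => [|U c IH]; first by rewrite mul0r !raddf0 mulr0 addr0 raddf0.
rewrite (raddfD dX) /= dXM dXX dXC mulr0 addr0 [in LHS]raddfD /=.
rewrite nordMX nordC mulrDr mulrA IH d_horner_alg mulrDl -nordC -nordMX -nordC -nordMX.
rewrite -!raddfD /=; congr nord; ring.
Qed.

(** On symbols this mirrors (u d) v = u (d v), by [d_nord]. It follows from the Leibniz rule for
    divided derivatives of [U * 'X]. *)
Lemma starMX n U V : (size U <= n)%N -> 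
  star n.+1 (U * 'X) V = star n U ('X * V + dX V).
Proof.
move=> szU; have iterD s A C : iter s dX (A + C) = iter s dX A + iter s dX C.
  by elim: s => //= s ->; rewrite raddfD.
have iterX s A : iter s dX ('X * A) = 'X * iter s dX A.
  by elim: s => //= s ->; rewrite dXM dXX mul0r add0r.
rewrite /star big_ord_recl nderivn0 /=.
under eq_bigr => s _.
  rewrite /bump leq0n add1n -[U * 'X]addr0 -polyC0 nderivnMXaddC mulrDl -mulrA.
over.
rewrite big_split /=; under [RHS]eq_bigr => s _ do rewrite iterD iterX mulrDr -iterSr.
rewrite big_split /= addrCA addrC; congr (_ + _).
case: n szU => [|n] szU.
  by move: szU; rewrite leqn0 size_poly_eq0 => /eqP->; rewrite !big_ord0 !mul0r addr0.
(* The remaining sums differ by a shift of s; the extra last term contains a divided derivative of U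
   that vanishes by the size bound. *)
rewrite big_ord_recr [RHS]big_ord_recl /= nderivn0 /=.
rewrite (nderivn_poly0 szU) mul0r addr0 mulrA; congr (_ + _).
Qed.

Lemma starC n c V : star n.+1 c%:P V = c%:P * V.
Proof.
rewrite /star big_ord_recl nderivn0 /= big1 ?addr0 // => s _.
by rewrite nderivnC mul0r.
Qed.

(** Peel one d off U: [d_nord] moves it past V, and [starMX] is the same recursion on symbols. *)
Lemma nordM n U V : (size U <= n)%N -> nord U * nord V = nord (star n U V).
Proof.
elim/poly_ind: U n V => [|U c IH] n V szU.
  by rewrite raddf0 mul0r /star big1 ?raddf0 // => s _; rewrite linear0 mul0r.
case: n szU => [|n] szU.
  move: szU; rewrite leqn0 size_poly_eq0 => /eqP ->.
  by rewrite raddf0 mul0r /star big_ord0 raddf0.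
have szUn : (size U <= n)%N.
  by move: szU; rewrite size_MXaddC; case: ifP => [/andP[/eqP-> _]|_]; rewrite ?size_poly0.
rewrite starDl starMX // starC [X in X * _]raddfD /= [in RHS]raddfD /= -IH //.
by rewrite nordMX nordCM nordC mulrDl -mulrA d_nord [V * 'X]mulrC.
Qed.

Lemma nord_commutator n U V : (size U <= n)%N -> (size V <= n)%N ->
  nord U * nord V - nord V * nord U = nord (star n U V - star n V U).
Proof. by move=> Un Vn; rewrite (nordM _ Un) (nordM _ Vn) raddfB. Qed.

Lemma nord_deriv U : nord U^`() = nord U * x - x * nord U.
Proof.
elim/poly_ind: U => [|U c IH]; first by rewrite deriv0 raddf0 mul0r mulr0 subrr.
rewrite derivD derivC addr0 derivM derivX mulr1 !raddfD /= !nordMX nordC IH.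
have hxC : hx c * x = x * hx c 
  by rewrite -[X in _ * X = X * _](horner_algX x) -!(rmorphM hx) mulrC.
rewrite !mulrDl mulrDr hxC opprD addrACA subrr addr0.
by rewrite -[_ * d * x]mulrA dx_rel mulrDr mulr1 mulNr !mulrA addrAC.
Qed.

(** Commuting c(x) = 0 with d gives c'(x) = 0, so c' = 0 by induction on the size and c is constant
    in characteristic 0. *)
Lemma horner_alg_inj c : hx c = 0 -> c = 0.
Proof.
have [m] := ubnP (size c); elim: m c => // m IH c szc hc.
have [szc1|szc1] := leqP (size c) 1.
  move: hc; rewrite (size1_polyC szc1) horner_algC => /eqP.
  by rewrite scaler_eq0 oner_eq0 orbF => /eqP->.
have c0 : c != 0 by rewrite -size_poly_gt0 (leq_trans _ szc1).
have c'0 : c^`() = 0.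
  apply: IH; first by rewrite (leq_trans (lt_size_deriv c0)).
  by have /esym/eqP := d_horner_alg c; rewrite hc mulr0 mul0r add0r => /eqP.
have := @dX_eq0 F c%:P (size c).-1 0; rewrite dXC c'0 => /(_ erefl).
rewrite coefC eqxx -/(lead_coef c) lead_coef_eq0 => /(_ c0); lia.
Qed.

(** Commutation with x differentiates the symbol in d, which reduces the claim to symbols constant
    in d. *)
Lemma nord_eq0 U : nord U = 0 -> U = 0.
Proof.
have [m] := ubnP (size U); elim: m U => // m IH U szU NU.
have [szU1|szU1] := leqP (size U) 1.
  by move: NU; rewrite (size1_polyC szU1) nordC => /horner_alg_inj->.
have U0 : U != 0 by rewrite -size_poly_gt0 (leq_trans _ szU1).
have U'0 : U^`() = 0.
  apply: IH; first by rewrite (leq_trans (lt_size_deriv U0)).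
  by rewrite nord_deriv NU mul0r mulr0 subrr.
have := @deriv_eq0 F U (size (lead_coef U)).-1 (size U).-1 U'0.
rewrite -/(lead_coef U) -/(lead_coef (lead_coef U)) !lead_coef_eq0 => /(_ U0); lia.
Qed.

Lemma nord_inj : injective nord.
Proof.
move=> U V eqUV; apply/eqP; rewrite -subr_eq0; apply/eqP/nord_eq0.
by rewrite raddfB /= eqUV subrr.
Qed.

End NormalOrder.

(** * Order in d *)

Section OrderSymbol.
Variables (F : numFieldType) (W : algType F) (x d : W).
Hypothesis dx_rel : d * x = x * d + 1.
Local Notation B := {poly {poly F}}.
Local Notation hx := (horner_alg x).
Local Notation nord := (nord x d).
Implicit Types (U V : B) (c e : {poly F}) (u v : W).

(* u has order at most n in d, and c is its coefficient at d^n, possibly 0. *)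
Definition osym n c u :=
  exists U, [/\ u = nord U, (size U <= n.+1)%N & U`_n = c].

(** For the weights (0, 1) the weight is the order in d, so the weighted estimates apply to
    [osym]. *)
Lemma size_leP n U : (size U <= n.+1)%N <-> wsupp 0 1 (fun w => w <= n)%N U.
Proof.
split=> [szU i j|SU].
  rewrite mul0n mul1n add0n; apply: contraNT; rewrite -ltnNge => ltnj.
  by rewrite [U`_j]nth_default ?coef0 // (leq_trans szU).
apply/leq_sizeP => j ltnj; apply/polyP => i; rewrite coef0; apply/eqP.
by apply: contraT => /SU; rewrite mul0n mul1n add0n leqNgt ltnj.
Qed.

Lemma coef_wsupp_eq0 n U : wsupp 0 1 (fun w => w < n)%N U -> U`_n = 0.
Proof.
move=> SU; apply/polyP => i; rewrite coef0; apply/eqP.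
by apply: contraT => /SU; rewrite mul0n mul1n add0n ltnn.
Qed.

Lemma osym_inj n c e u : osym n c u -> osym n e u -> c = e.
Proof. by move=> [U [-> _ <-]] [V [/(nord_inj dx_rel)-> _ <-]]. Qed.

Lemma osym_norm n U : (size U <= n.+1)%N -> osym n U`_n (nord U).
Proof. by move=> szU; exists U. Qed.

Lemma osymC c : osym 0 c (hx c).
Proof. by exists c%:P; rewrite nordC coefC size_polyC; split=> //; case: eqP. Qed.

Lemma osym0 n : osym n 0 0.
Proof. by exists 0; rewrite raddf0 size_poly0 coef0. Qed.

Lemma osym_lt m n c u : (m < n)%N -> osym m c u -> osym n 0 u.
Proof.
move=> mn [U [-> szU _]]; exists U; split=> //; first by rewrite (leq_trans szU) // ltnW.
by rewrite nth_default // (leq_trans szU).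
Qed.

Lemma osymD n c e u v : osym n c u -> osym n e v -> osym n (c + e) (u + v).
Proof.
move=> [U [-> szU <-]] [V [-> szV <-]]; exists (U + V).
by rewrite raddfD coefD (leq_trans (size_polyD _ _)) // geq_max szU.
Qed.

Lemma osymZ n c u (k : F) : osym n c u -> osym n (k *: c) (k *: u).
Proof.
move=> [U [-> szU <-]]; exists (k%:P *: U); rewrite nordZ coefZ mul_polyC.
by split=> //; apply: leq_trans (size_scale_leq _ _) szU.
Qed.

Lemma osymB n c e u v : osym n c u -> osym n e v -> osym n (c - e) (u - v).
Proof.
move=> cu /(osymZ (-1)); rewrite !scaleN1r => ev; exact: osymD.
Qed.

Lemma osym_sum n (I : Type) (r : seq I) (c : I -> {poly F}) (u : I -> W) :
  (forall i, osym n (c i) (u i)) -> osym n (\sum_(i <- r) c i) (\sum_(i <- r) u i).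
Proof.
move=> cu; elim: r => [|i r IH]; first by rewrite !big_nil; apply: osym0.
by rewrite !big_cons; apply: osymD.
Qed.

(** By [star_top] the symbol of the product differs from the commutative product only in order below
    m + n. *)
Lemma osymM m n c e u v : osym m c u -> osym n e v -> osym (m + n) (c * e) (u * v).
Proof.
move=> [U [-> szU <-]] [V [-> szV <-]]; rewrite (@nordM _ _ _ _ dx_rel (size U).+1) ?leqW //.
have SU : wsupp 0 1 (fun w => w + 0 <= m)%N U.
  by apply: wsupp_mono (iffLR (size_leP _ _) szU) => k; rewrite addn0.
have SV : wsupp 0 1 (fun w => w + 0 <= n)%N V.
  by apply: wsupp_mono (iffLR (size_leP _ _) szV) => k; rewrite addn0.
have top := star_top (n := size U) SU SV.
have UV : wsupp 0 1 (fun w => w <= m + n)%N (U * V).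
  by apply: wsuppM SU SV => k l; lia.
exists (star (size U).+1 U V); split=> //.
  apply/size_leP; rewrite -[star _ _ _](subrK (U * V)); apply: wsuppD => //.
  by apply: wsupp_mono top => k; lia.
rewrite -(coefM_top szU szV); apply/eqP; rewrite -subr_eq0 -coefB; apply/eqP.
by apply: coef_wsupp_eq0; apply: wsupp_mono top => k; lia.
Qed.

Lemma osymXn m c u k : osym m c u -> osym (m * k) (c ^+ k) (u ^+ k).
Proof.
move=> cu; elim: k => [|k IH].
  by rewrite muln0 !expr0 -(rmorph1 hx); apply: osymC.
by rewrite mulnS !exprS; apply: osymM.
Qed.

(** Up to order below k = m + n - 1 the symbol of the commutator is {U, V}, whose coefficient at d^k
    involves only the leading coefficients. *)
Lemma osym_commutator m n k c e u v : osym m c u -> osym n e v ->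
  (m + n)%N = k.+1 ->
  osym k ((c * e^`()) *+ m - (c^`() * e) *+ n) (u * v - v * u).
Proof.
move=> [U [-> szU <-]] [V [-> szV <-]] mnk; pose l := (size U + size V)%N.
rewrite (@nord_commutator _ _ _ _ dx_rel l.+2) /l; try lia.
have SU : wsupp 0 1 (fun w => w + 0 <= m)%N U.
  by apply: wsupp_mono (iffLR (size_leP _ _) szU) => j; rewrite addn0.
have SV : wsupp 0 1 (fun w => w + 0 <= n)%N V.
  by apply: wsupp_mono (iffLR (size_leP _ _) szV) => j; rewrite addn0.
have UV := star_top2 (n := l) SU SV; have VU := star_top2 (n := l) SV SU.
have SP : wsupp 0 1 (fun w => w <= k)%N (pb U V).
  by apply: wsupp_pb SU SV => i j /=; lia.
have SW : wsupp 0 1 (fun w => w < k)%N (star l.+2 U V - star l.+2 V U - pb U V).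
  have -> : star l.+2 U V - star l.+2 V U - pb U V =
     (star l.+2 U V - U * V - U^`() * dX V) - (star l.+2 V U - V * U - V^`() * dX U).
    by rewrite /pb; ring.
  by apply: wsuppB; [apply: wsupp_mono UV | apply: wsupp_mono VU] => i /=; lia.
exists (star l.+2 U V - star l.+2 V U); split=> //.
  apply/size_leP; rewrite -[X in wsupp _ _ _ X](subrK (pb U V)).
  by apply: wsuppD => //; apply: wsupp_mono SW => i; lia.
have -> : (star l.+2 U V - star l.+2 V U)`_k = (pb U V)`_k.
  by apply/eqP; rewrite -subr_eq0 -coefB; apply/eqP/coef_wsupp_eq0.
have szdX (Q : B) j : (size Q <= j)%N -> (size (dX Q) <= j)%N.
  by move=> szQ; rewrite (leq_trans (size_poly _ _)).
(* The derivative in d lowers the size bound by one, so k splits as (i - 1) + j; for i = 0 that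
   derivative is zero. *)
have top (P Q : B) i j : (size P <= i.+1)%N -> (size Q <= j.+1)%N -> (i + j)%N = k.+1 ->
    (P^`() * dX Q)`_k = (P`_i * (Q`_j)^`()) *+ i.
  case: i => [|i] szP szQ ijk.
    by rewrite (size1_polyC szP) derivC mul0r coef0 mulr0n.
  rewrite (_ : k = i + j)%N ?coefM_top ?szdX //; last by lia.
    by rewrite coef_deriv coef_dX mulrnAl.
  have [->|P0] := eqVneq P 0; first by rewrite deriv0 size_poly0.
  by rewrite -ltnS (leq_trans (lt_size_deriv P0)).
by rewrite /pb coefB (top _ _ _ _ szU szV) //
  [dX U * _]mulrC (top _ _ _ _ szV szU) 1?addnC // [V`_n * _]mulrC.
Qed.

End OrderSymbol.

(** * Orders of the images of the generators *)

Section Automorphism.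
Variables (F : numFieldType) (W : algType F) (x d : W).
Hypothesis dx_rel : d * x = x * d + 1.
Hypothesis nord_surj : forall u, exists U, u = nord x d U.
Local Notation B := {poly {poly F}}.
Local Notation hx := (horner_alg x).
Local Notation nord := (nord x d).
Local Notation osym := (osym x d).
Implicit Types (U V : B) (c e f g : {poly F}) (u v : W).

Definition ad u v := u * v - v * u.

(** Each commutator with U shifts the weight by n - (a + b) and acts on the top part as {P, _}, by
    [star_commutator_top]. The resulting top part may be zero. *)
Lemma iter_ad_top a b n U P V k : (0 < a + b)%N ->
  wsupp a b (fun w => w = n) P -> wsupp a b (fun w => w < n)%N (U - P) ->
  forall m, wsupp a b (fun w => w = m) V ->
  exists Vk, [/\ iter k (ad (nord U)) (nord V) = nord Vk,
    wsupp a b (fun w => w + k * (a + b) = m + k * n)%N (iter k (pb P) V) &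
    wsupp a b (fun w => w + k * (a + b) < m + k * n)%N (Vk - iter k (pb P) V)].
Proof.
move=> ab0 SP SUP m SV; elim: k => [|k [Vk [NVk S0 Sk]]].
  exists V; split=> //=; first by apply: wsupp_mono SV => w; lia.
  by rewrite subrr; apply: wsupp0.
pose l := (size U + size Vk)%N.
have [S0' Sk'] := star_commutator_top l ab0 SP SUP S0 Sk.
exists (star l.+2 U Vk - star l.+2 Vk U); split.
- rewrite iterS NVk /ad (@nord_commutator _ _ _ _ dx_rel l.+2) // /l; lia.
- by rewrite iterS; apply: wsupp_mono S0' => w; lia.
- by rewrite iterS; apply: wsupp_mono Sk' => w; lia.
Qed.

(** When the iterated commutator vanishes, the iterated bracket is both homogeneous of its weight
    and supported strictly below it. *)
Lemma iter_ad_eq0 a b n U P V k m : (0 < a + b)%N ->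
  wsupp a b (fun w => w = n) P -> wsupp a b (fun w => w < n)%N (U - P) ->
  wsupp a b (fun w => w = m) V ->
  iter k (ad (nord U)) (nord V) = 0 -> iter k (pb P) V = 0.
Proof.
move=> ab0 SP SUP SV; have [Vk [-> S0 Sk]] := iter_ad_top k ab0 SP SUP SV.
move=> /(nord_eq0 dx_rel) Vk0; apply/polyP => j; apply/polyP => i; rewrite !coef0.
apply/eqP; apply: contraT => nz; have eqS := S0 _ _ nz.
have := Sk i j; rewrite Vk0 sub0r !coefN oppr_eq0 => /(_ nz); lia.
Qed.

(** On symbols [ad x] is minus the derivative in d, which lowers the size. *)
Lemma ad_x_nilpotent v : exists k, iter k (ad x) v = 0.
Proof.
have [V ->] := nord_surj v; have [n] := ubnP (size V); elim: n V => // n IH V szV.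
have adV U : ad x (nord U) = nord (- U^`()).
  by rewrite /ad -opprB -(nord_deriv dx_rel) raddfN.
have [->|V0] := eqVneq V 0; first by exists 0%N; rewrite raddf0.
have [|k kE] := IH (- V^`()).
  by rewrite size_polyN (leq_trans (lt_size_deriv V0)).
by exists k.+1; rewrite iterSr adV.
Qed.

Variable phi : {lrmorphism W -> W}.
Hypothesis phi_bij : bijective phi.

Lemma iter_ad_morph k u v : phi (iter k (ad u) v) = iter k (ad (phi u)) (phi v).
Proof.
elim: k => //= k <-; move: (iter _ _ v) => w.
by rewrite /ad rmorphB !rmorphM.
Qed.

Lemma ad_nilpotent u : phi u = x -> forall v, exists k, iter k (ad u) v = 0.
Proof.
move=> ux v; have [k] := ad_x_nilpotent (phi v); rewrite -ux -iter_ad_morph => kE.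
by exists k; apply: (bij_inj phi_bij); rewrite kE rmorph0.
Qed.

Variables (a b : nat) (f g : {poly F}).
Hypotheses (f0 : f != 0) (g0 : g != 0) (a0 : (0 < a)%N) (b0 : (0 < b)%N).
Hypotheses (symx : osym a f (phi x)) (symd : osym b g (phi d)).


(** The image of x^i d^j has order a i + b j and leading coefficient f^i g^j. The coefficient at d^n
    is therefore the weight-n part of U evaluated at (f, g), which may cancel to 0. *)
Lemma osym_phi n U : wsupp a b (fun w => w <= n)%N U ->
  osym n (\sum_(j < size U) \sum_(i < size U`_j)
    (if (a * i + b * j == n)%N then U`_j`_i *: (f ^+ i * g ^+ j) else 0)) (phi (nord U)).
Proof.
move=> SU; rewrite nordE rmorph_sum; apply: osym_sum => j.
rewrite rmorph_sum; apply: osym_sum => i /=; rewrite linearZ rmorphM !rmorphXn /=.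
have sym : osym (a * i + b * j) (f ^+ i * g ^+ j) (phi x ^+ i * phi d ^+ j).
  by apply: (osymM dx_rel); apply: (osymXn dx_rel).
have [U0|/SU] := eqVneq U`_j`_i 0.
  by rewrite U0 !scale0r if_same; apply: osym0.
rewrite leq_eqVlt; have [<- _|_ /= lt] := eqVneq; first exact: osymZ.
by rewrite -[X in osym _ X](scaler0 _ U`_j`_i); apply: osymZ; apply: osym_lt sym.
Qed.

(** For a monomial P no cancellation can occur in [osym_phi], so the image of U would have order
    exactly n, whereas x has order 0. *)
Lemma top_not_monomial n U P : phi (nord U) = x ->
  wsupp a b (fun w => w = n) P -> wsupp a b (fun w => w < n)%N (U - P) ->
  forall i0 j0, P`_j0`_i0 != 0 ->
    exists i j, P`_j`_i != 0 /\ ((i != i0) || (j != j0)).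
Proof.
move=> Ux SP SUP i0 j0 P0; apply: contrapT => nex.
have uniqP i j : P`_j`_i != 0 -> i = i0 /\ j = j0.
  move=> Pij; apply: contrapT => ne; case: nex; exists i, j; split=> //.
  rewrite -negb_and; apply/negP => /andP[/eqP ? /eqP ?]; exact: ne.
have nE : (a * i0 + b * j0 = n)%N by apply: SP.
have UPtop i j : (a * i + b * j = n)%N -> U`_j`_i = P`_j`_i.
  move=> w; apply/eqP; rewrite -subr_eq0 -!coefB; apply: contraT => /SUP.
  by rewrite w ltnn.
have SU : wsupp a b (fun w => w <= n)%N U.
  rewrite -[U](subrK P); apply: wsuppD; [apply: wsupp_mono SUP | apply: wsupp_mono SP];
  by move=> w /=; lia.
have := osym_phi SU; rewrite Ux.
have U0 : U`_j0`_i0 != 0 by rewrite (UPtop _ _ nE).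
have ltj : (j0 < size U)%N.
  by rewrite ltnNge; apply: contraNN U0 => /(nth_default 0) ->; rewrite coef0.
have lti : (i0 < size (U`_j0)%R)%N.
  by rewrite ltnNge; apply: contraNN U0 => /(nth_default 0) ->.
have zero (i j : nat) : (i != i0) || (j != j0) ->
    (if (a * i + b * j == n)%N then U`_j`_i *: (f ^+ i * g ^+ j) else 0) = 0.
  move=> ne; case: ifP => // /eqP w; rewrite (UPtop _ _ w).
  have [->|/uniqP[ei ej]] := eqVneq P`_j`_i 0.
    by rewrite scale0r.
  by rewrite ei ej !eqxx in ne.
rewrite (bigD1 (Ordinal ltj)) //= (bigD1 (Ordinal lti)) //= nE eqxx.
rewrite big1 ?addr0; last by move=> i ne; apply: zero; rewrite -val_eqE in ne; rewrite ne.
rewrite big1 ?addr0; last first.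
  move=> j ne; rewrite big1 // => i _; apply: zero.
  by rewrite -val_eqE in ne; rewrite ne orbT.
move=> symn; have sx : osym 0 'X x.
  by rewrite -[x in osym _ _ x]horner_algX; apply: osymC.
have [n0|n0] := posnP n; last first.
  have /(osym_inj dx_rel symn)/eqP := osym_lt n0 sx.
  by rewrite scaler_eq0 (negPf U0) /= mulf_eq0 !expf_eq0 (negPf f0) (negPf g0) !andbF.
(* In the remaining case n = 0, positivity of the weights makes U a constant; its image is a
   constant too and cannot be x. *)
have [i00 j00] : i0 = 0%N /\ j0 = 0%N.
  by move: nE a0 b0; rewrite n0; case: i0 j0 {P0 nex uniqP U0 ltj lti zero symn} => [|i] [|j]; nia.
have Uconst : U = (U`_0`_0)%:P%:P.
  apply/polyP => j; apply/polyP => i; rewrite coefC.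
  have := @SU i j; rewrite n0 leqn0 addn_eq0 !muln_eq0 !eqn0Ngt a0 b0 /=.
  case: j => [|j]; case: i => [|i] //=; rewrite ?coefC ?coef0 //;
  by move=> H; apply/eqP; apply: contraT => /H.
have : x = nord (U`_0`_0)%:P%:P by rewrite -Uconst -{1}Ux Uconst nordCC linearZ rmorph1.
rewrite -[x in x = _](nordXP x d) => /(nord_inj dx_rel)/(congr1 (fun V : B => V`_0`_1)).
by rewrite !coefC coefX /= => /eqP; rewrite oner_eq0.
Qed.

Lemma phi_orders_dvdn : (a %| b)%N || (b %| a)%N.
Proof.
apply: contraT; rewrite negb_or => /andP[ab ba]; exfalso.
have ab0 : (0 < a + b)%N by rewrite addn_gt0 a0.
case: phi_bij => psi phiK psiK; have [U UE] := nord_surj (psi x).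
have Ux : phi (nord U) = x by rewrite -UE psiK.
have U0 : U != 0.
  apply/eqP => U0; have := nord_inj dx_rel (_ : nord 'X%:P = nord 0).
  rewrite nordXP -Ux U0 !raddf0 => /(_ erefl)/eqP.
  by rewrite polyC_eq0 polyX_eq0.
have [n [P [SP SUP Pnz]]] := exists_top a b U0.
have nil := ad_nilpotent Ux.
have [k kE] := nil x; have [l lE] := nil d.
apply: (no_lnd_quasihomogeneous a0 b0 ab ba SP Pnz (top_not_monomial Ux SP SUP) (k := k) (l := l)).
  apply: (iter_ad_eq0 ab0 SP SUP (m := a)); last by rewrite nordXP.
  move=> i [|j]; rewrite coefC ?coef0 ?eqxx //= coefX.
  by case: (i =P 1%N) => [->|_]; rewrite ?eqxx // muln1 muln0 addn0.
apply: (iter_ad_eq0 ab0 SP SUP (m := b)); last by rewrite nordX.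
move=> i j; rewrite coefX; case: (j =P 1%N) => [->|_]; last by rewrite coef0 eqxx.
by rewrite coef1; case: (i =P 0%N) => [->|_]; rewrite ?eqxx // muln1 muln0 add0n.
Qed.

End Automorphism.

(** * Dixmier's theorem *)

Section Tame.
Variables (F : numFieldType) (W : algType F) (x d : W).
Hypothesis dx_rel : d * x = x * d + 1.
Hypothesis nord_surj : forall u, exists U, u = nord x d U.
Hypothesis weyl_univ : forall X D : W, D * X = X * D + 1 ->
  exists phi : {lrmorphism W -> W}, phi x = X /\ phi d = D.
Local Notation B := {poly {poly F}}.
Local Notation hx := (horner_alg x).
Local Notation hd := (horner_alg d).
Local Notation nord := (nord x d).
Local Notation osym := (osym x d).
Local Notation endo := {lrmorphism W -> W}.
Implicit Types (U V : B) (c e f g : {poly F}) (u v : W) (phi psi theta : endo).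

(** Scalings and the maps fixing x share one constructor. Composition is taken up to pointwise
    equality because endomorphisms are bundled with their structure. *)
Inductive tame : endo -> Prop :=
| TameUpper phi (k : F) c : k != 0 ->
    phi x = k *: x -> phi d = k^-1 *: d + hx c -> tame phi
| TameLower phi c : phi x = x + hd c -> phi d = d -> tame phi
| TameComp phi psi (theta : endo) :
    tame phi -> tame psi -> theta =1 phi \o psi -> tame theta.

Lemma endo_ext phi psi : phi x = psi x -> phi d = psi d -> phi =1 psi.
Proof.
move=> ex ed u; have [U ->] := nord_surj u; rewrite nordE !rmorph_sum.
apply: eq_bigr => j _; rewrite !rmorph_sum; apply: eq_bigr => i _ /=.
by rewrite !linearZ /= !rmorphM !rmorphXn /= ex ed.
Qed.

Lemma horner_alg_morph phi u c : phi (horner_alg u c) = horner_alg (phi u) c.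
Proof.
rewrite !horner_algE rmorph_sum; apply: eq_bigr => i _ /=.
by rewrite linearZ rmorphXn.
Qed.

Lemma horner_algZXn u (k : F) q : horner_alg u (k *: 'X^q) = k *: u ^+ q.
Proof. by rewrite -mul_polyC rmorphM rmorphXn /= horner_algC horner_algX -scalerAl mul1r. Qed.

Lemma horner_alg_comm u c : horner_alg u c * u = u * horner_alg u c.
Proof. by rewrite -[X in _ * X = X * _](horner_algX u) -!(rmorphM (horner_alg u)) mulrC. Qed.

(** The inverse [eps'] is the map of the same form for [- c]; its tameness is what [tame_compK] uses
    to undo [eps]. *)
Lemma exists_upper c : exists eps eps' : endo,
  [/\ eps x = x, eps d = d + hx c, tame eps', bijective eps & eps \o eps' =1 id].
Proof.
have rel e : (d + hx e) * x = x * (d + hx e) + 1.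
  by rewrite mulrDl mulrDr dx_rel horner_alg_comm addrAC.
have [eps [epsx epsd]] := weyl_univ (rel c).
have [eps' [epsx' epsd']] := weyl_univ (rel (- c)).
have e1 : (eps \o eps' : endo) =1 (idfun : endo).
  apply: endo_ext; rewrite /= ?epsx' ?epsx // epsd' rmorphD /= horner_alg_morph epsd epsx.
  by rewrite rmorphN addrK.
have e2 : (eps' \o eps : endo) =1 (idfun : endo).
  apply: endo_ext; rewrite /= ?epsx ?epsx' // epsd rmorphD /= horner_alg_morph epsd' epsx'.
  by rewrite rmorphN subrK.
exists eps, eps'; split=> //; last by exists eps'.
by apply: (@TameUpper _ 1 (- c)); rewrite ?oner_eq0 ?invr1 ?scale1r.
Qed.

Lemma exists_lower c : exists eps eps' : endo,
  [/\ eps x = x + hd c, eps d = d, tame eps', bijective eps & eps \o eps' =1 id].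
Proof.
have rel e : d * (x + hd e) = (x + hd e) * d + 1.
  by rewrite mulrDl mulrDr dx_rel horner_alg_comm addrAC.
have [eps [epsx epsd]] := weyl_univ (rel c).
have [eps' [epsx' epsd']] := weyl_univ (rel (- c)).
have e1 : (eps \o eps' : endo) =1 (idfun : endo).
  apply: endo_ext; rewrite /= ?epsd' ?epsd // epsx' rmorphD /= horner_alg_morph epsd epsx.
  by rewrite rmorphN addrK.
have e2 : (eps' \o eps : endo) =1 (idfun : endo).
  apply: endo_ext; rewrite /= ?epsd ?epsd' // epsx rmorphD /= horner_alg_morph epsd' epsx'.
  by rewrite rmorphN subrK.
exists eps, eps'; split=> //; last by exists eps'.
exact: (@TameLower _ (- c)).
Qed.

(** phi equals (phi eps) eps', so phi may be simplified by composing with elementary maps on the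
    right. *)
Lemma tame_compK phi (eps eps' : endo) :
  eps \o eps' =1 id -> tame eps' -> tame (phi \o eps : endo) -> tame phi.
Proof.
move=> epsK te tpe; apply: TameComp tpe te _ => u /=.
by have /= -> := epsK u.
Qed.

Lemma endo_rel phi : phi d * phi x - phi x * phi d = 1.
Proof. by rewrite -!rmorphM -rmorphB dx_rel addrAC subrr add0r rmorph1. Qed.

Lemma deriv_eq0_polyC f : f^`() = 0 -> f = (f`_0)%:P.
Proof.
move=> f'0; apply/polyP => -[|i]; rewrite coefC //=.
have := congr1 (fun h : {poly F} => h`_i) f'0; rewrite coef_deriv coef0 => /eqP.
by rewrite -mulr_natr mulf_eq0 Num.Theory.pnatr_eq0 orbF => /eqP.
Qed.

Lemma endo_x_notin_F phi (k : F) : phi x != k%:A.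
Proof.
apply/eqP => xk; have := endo_rel phi.
by rewrite xk -scalerAl -scalerAr mul1r mulr1 subrr => /esym/eqP; rewrite oner_eq0.
Qed.

(** If phi(d) has order k + 1 with leading coefficient v, the coefficient of [phi(d), f(x)] = 1 at
    d^k is (k + 1) v f'. Hence k = 0 and v f' = 1, so f is affine and v is the inverse of its
    slope. *)
Lemma tame_order0 phi f : phi x = hx f -> tame phi.
Proof.
move=> phix; have [V dV] := nord_surj (phi d).
have V0 : V != 0.
  apply/eqP => V0; have := endo_rel phi.
  by rewrite dV V0 raddf0 mul0r mulr0 subrr => /esym/eqP; rewrite oner_eq0.
have f'0 : f^`() != 0.
  apply/eqP => /deriv_eq0_polyC fC; have := endo_x_notin_F phi f`_0.
  by rewrite phix fC horner_algC coefC eqxx.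
have sym1 : osym 0 1 1 by rewrite -(rmorph1 hx); apply: osymC.
have symx : osym 0 f (phi x) by rewrite phix; apply: osymC.
(* Were phi(d) of order 0, it would commute with phi(x), both being polynomials in x. *)
have [k szV] : exists k, size V = k.+2.
  case szV : (size V) => [|[|k]]; last by exists k.
    by move/eqP: szV; rewrite size_poly_eq0 (negPf V0).
  have := endo_rel phi; rewrite phix dV (size1_polyC (eq_leq szV)) nordC.
  by rewrite -!(rmorphM hx) mulrC subrr => /esym/eqP; rewrite oner_eq0.
have symd : osym k.+1 V`_k.+1 (phi d) by rewrite dV; apply: osym_norm; rewrite szV.
have := osym_commutator dx_rel symd symx (addn0 _).
rewrite endo_rel mulr0n subr0 => sym1'.
have lV : V`_k.+1 != 0 by rewrite -[k.+1]/(k.+2.-1) -szV lead_coef_eq0.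
case: k szV symd sym1' lV => [|k] szV symd sym1' lV; last first.
  have /(osym_inj dx_rel sym1')/eqP := osym_lt (ltn0Sn k) sym1.
  by rewrite -mulr_natr !mulf_eq0 (negPf lV) (negPf f'0) -polyC_natr polyC_eq0 Num.Theory.pnatr_eq0.
have Vf : V`_1 * f^`() = 1 by have := osym_inj dx_rel sym1' sym1; rewrite mulr1n.
have szf : size f^`() = 1%N.
  have : f^`() \is a GRing.unit by apply/unitrPr; exists V`_1; rewrite mulrC.
  by rewrite poly_unitE => /andP[/eqP].
have szV1 : size V`_1 = 1%N.
  have : V`_1 \is a GRing.unit by apply/unitrPr; exists f^`().
  by rewrite poly_unitE => /andP[/eqP].
pose al := f^`()`_0; have f'E : f^`() = al%:P by apply: size1_polyC; rewrite szf.
have VE : V`_1 = al^-1%:P.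
  have V1E : V`_1 = (V`_1`_0)%:P by apply: size1_polyC; rewrite szV1.
  move: Vf; rewrite V1E f'E -polyCM => /polyC_inj Val; congr _%:P.
  have al0 : al != 0 by apply/eqP => al0; move/eqP: Val; rewrite al0 mulr0 eq_sym oner_eq0.
  by apply: (mulIf al0); rewrite Val mulVf.
have al0 : al != 0 by rewrite -polyC_eq0 -f'E.
have [ga fE] : exists ga, f = al *: 'X + ga%:P.
  exists (f - al *: 'X)`_0; rewrite -(@deriv_eq0_polyC (f - al *: 'X)).
    by rewrite addrC subrK.
  by rewrite derivB derivZ derivX f'E alg_polyC subrr.
have xE : phi x = al *: x + ga%:A.
  by rewrite phix fE raddfD /= linearZ /= horner_algX horner_algC -scalerAl mul1r.
have dE : phi d = al^-1 *: d + hx V`_0.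
  have VEE : V = al^-1%:P%:P * 'X + (V`_0)%:P.
    apply/polyP => -[|[|i]]; rewrite coefD coefMX coefC ?add0r ?addr0 //=.
      by rewrite coefC.
    by rewrite coefC /= nth_default // szV.
  by rewrite dV {1}VEE raddfD /= nordCM nordX nordC horner_algC -scalerAl mul1r.
(* [TameUpper] allows no translation of x, so the constant term is removed by a lower map with
   constant polynomial. *)
have [eps [eps' [epsx epsd te _ epsK]]] := exists_lower (- ga%:P).
apply: tame_compK epsK te _; apply: (@TameUpper _ al V`_0) => //=.
  by rewrite epsx rmorphD /= horner_alg_morph rmorphN /= horner_algC xE addrK.
by rewrite epsd dE.
Qed.

(** The composite of d -> d + x and x -> x - d sends x to -d, which reduces the claim to
    [tame_order0]. *)
Lemma tame_order0_d phi g : phi d = hx g -> tame phi.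
Proof.
move=> phid.
have [e1 [e1' [e1x e1d te1 _ e1K]]] := exists_upper 'X.
have [e2 [e2' [e2x e2d te2 _ e2K]]] := exists_lower (- 'X).
apply: tame_compK e1K te1 _; apply: tame_compK e2K te2 _.
apply: (@tame_order0 _ (- g)) => /=.
rewrite e2x rmorphN /= horner_algX rmorphB /= e1x e1d horner_algX.
by rewrite opprD addrCA subrr addr0 !rmorphN /= phid.
Qed.

Lemma osym_size_lt n u : osym n 0 u -> exists U, u = nord U /\ (size U <= n)%N.
Proof.
move=> [U [-> szU Un]]; exists U; split=> //.
apply/leq_sizeP => j; rewrite leq_eqVlt => /orP[/eqP<-//|lt].
by rewrite nth_default // (leq_trans szU).
Qed.

(** Dividing by a gives q g f' = g' f, so g and f^q have zero Wronskian. *)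
Lemma power_of_proportional f g a q : (0 < a)%N -> f != 0 ->
  (g * f^`()) *+ (a * q) = (g^`() * f) *+ a -> exists k, g = k *: f ^+ q.
Proof.
move=> a0 f0; have [->|g0] := eqVneq g 0; first by exists 0; rewrite scale0r.
rewrite mulnC mulrnA => /eqP; rewrite -subr_eq0 -mulrnBl -mulr_natr mulf_eq0.
rewrite -polyC_natr polyC_eq0 Num.Theory.pnatr_eq0 eqn0Ngt a0 orbF subr_eq0 => /eqP E.
apply: wronskian_eq0; first by rewrite expf_neq0.
case: q E => [|q] E.
  rewrite expr0 mulr1 -(polyC1 F) derivC mulr0; apply: (mulIf f0).
  by rewrite -E mulr0n mul0r.
by rewrite deriv_exp exprS mulrA -E mulrnAl mulrnAr mulrA.
Qed.

(** Strong induction on the sum of the sizes of the symbols of phi(x) and phi(d). The base cases are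
    those where one image has order 0. *)
Theorem dixmier phi : bijective phi -> tame phi.
Proof.
have [U xU] := nord_surj (phi x); have [V dV] := nord_surj (phi d).
have [n] := ubnP (size U + size V); elim: n phi U V xU dV => // n IH phi U V xU dV sz bij.
have [szU|szU] := leqP (size U) 1.
  by apply: (@tame_order0 _ U`_0); rewrite xU {1}(size1_polyC szU) nordC.
have [szV|szV] := leqP (size V) 1.
  by apply: (@tame_order0_d _ V`_0); rewrite dV {1}(size1_polyC szV) nordC.
pose a := (size U).-1; pose b := (size V).-1.
have szUa : size U = a.+1 by rewrite /a; lia.
have szVb : size V = b.+1 by rewrite /b; lia.
have a0 : (0 < a)%N by rewrite /a; lia.
have b0 : (0 < b)%N by rewrite /b; lia.
have f0 : lead_coef U != 0 by rewrite lead_coef_eq0 -size_poly_gt0 szUa.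
have g0 : lead_coef V != 0 by rewrite lead_coef_eq0 -size_poly_gt0 szVb.
have symx : osym a (lead_coef U) (phi x) by rewrite xU; apply: osym_norm; rewrite szUa.
have symd : osym b (lead_coef V) (phi d) by rewrite dV; apply: osym_norm; rewrite szVb.
move: (lead_coef U) (lead_coef V) f0 g0 symx symd => f g f0 g0 symx symd.
have sym1 : osym 0 1 1 by rewrite -(rmorph1 hx); apply: osymC.
(* As a and b are positive, 1 = [phi(d), phi(x)] has order 0 < b + a - 1, so its coefficient at
   order b + a - 1 vanishes. *)
have E : (g * f^`()) *+ b = (g^`() * f) *+ a.
  have ab : (b + a)%N = (b + a).-1.+1 by lia.
  have := osym_commutator dx_rel symd symx ab; rewrite endo_rel => symc.
  have := osym_lt (_ : 0 < (b + a).-1)%N sym1.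
  move=> /(_ _)/(osym_inj dx_rel symc)/eqP; rewrite subr_eq0 => H.
  by apply/eqP/H; lia.
have [/dvdnP[q bq]|/dvdnP[q aq]] :=
  orP (phi_orders_dvdn dx_rel nord_surj bij f0 g0 a0 b0 symx symd).
  have [k gE] : exists k, g = k *: f ^+ q.
    by apply: (power_of_proportional a0 f0); rewrite [(a * q)%N]mulnC -bq.
  (* Composing with d -> d - k x^q subtracts k phi(x)^q from phi(d) and cancels its leading term. *)
  have [eps [eps' [epsx epsd te beps epsK]]] := exists_upper (- (k *: 'X^q)).
  have symd' : osym b 0 ((phi \o eps : endo) d).
    rewrite /= epsd rmorphD /= horner_alg_morph rmorphN /= horner_algZXn.
    rewrite -(subrr g) {2}gE; apply: osymB => //; apply: osymZ.
    by rewrite bq mulnC; apply: (osymXn dx_rel).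
  have [V' [dV' szV']] := osym_size_lt symd'.
  apply: tame_compK epsK te _; apply: (IH _ U V') => //=; last exact: bij_comp.
    by rewrite epsx.
  by rewrite -ltnS; apply: leq_ltn_trans sz; rewrite szVb ltn_add2l ltnS.
have [k fE] : exists k, f = k *: g ^+ q.
  by apply: (power_of_proportional b0 g0); rewrite [(b * q)%N]mulnC -aq mulrC -E mulrC.
have [eps [eps' [epsx epsd te beps epsK]]] := exists_lower (- (k *: 'X^q)).
have symx' : osym a 0 ((phi \o eps : endo) x).
  rewrite /= epsx rmorphD /= horner_alg_morph rmorphN /= horner_algZXn.
  rewrite -(subrr f) {2}fE; apply: osymB => //; apply: osymZ.
  by rewrite aq mulnC; apply: (osymXn dx_rel).
have [U' [xU' szU']] := osym_size_lt symx'.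
apply: tame_compK epsK te _; apply: (IH _ U' V) => //=; last exact: bij_comp.
  by rewrite epsd.
by rewrite -ltnS; apply: leq_ltn_trans sz; rewrite szUa ltn_add2r ltnS.
Qed.


End Tame.

(** * Maps out of the quantum Weyl algebra *)

Section UniversalProperty.
Variables (K : comNzRingType) (q : K) (A : algType K) (X D : A).
Local Notation free2 := {malg K[{fmonom 'I_2}]}.

Definition word_eval (m : {fmonom 'I_2}) : A :=
  \prod_(i <- (m : seq 'I_2)) (if i == 0 then X else D).

Lemma word_eval_mmorphism : mmorphism word_eval.
Proof.
by split=> [m m'|]; rewrite /word_eval ?fmM ?big_cat // fm1 big_nil.
Qed.
HB.instance Definition _ :=
  isMultiplicative.Build {fmonom 'I_2} A word_eval word_eval_mmorphism.

Definition free2_eval : free2 -> A := locked (mmap (in_alg A) word_eval).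

Lemma free2_evalU c m : free2_eval << c *g m >> = c *: word_eval m.
Proof. by rewrite /free2_eval -lock mmapU /= -scalerAl mul1r. Qed.

Lemma free2_evalB u v : free2_eval (u - v) = free2_eval u - free2_eval v.
Proof. by rewrite /free2_eval -lock raddfB. Qed.

Lemma free2_eval_sum (I : Type) (s : seq I) (u : I -> free2) :
  free2_eval (\sum_(i <- s) u i) = \sum_(i <- s) free2_eval (u i).
Proof. by rewrite /free2_eval -lock raddf_sum. Qed.

Lemma free2_evalZ c u : free2_eval (c *: u) = c *: free2_eval u.
Proof. by rewrite /free2_eval -lock mmapZ /= -scalerAl mul1r. Qed.

Lemma in_alg_comm (c : K) (u : A) : GRing.comm (in_alg A c) u.
Proof. by rewrite /GRing.comm /= -scalerAl -scalerAr mul1r mulr1. Qed.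

Lemma free2_eval_is_monoid_morphism :
  free2_eval 1 = 1 /\ {morph free2_eval : u v / u * v}.
Proof.
have [hM h1] := @commr_mmap_is_multiplicative {fmonom 'I_2} K A (in_alg A) word_eval
  (fun g m m' => @in_alg_comm g@_m (word_eval m')).
by rewrite /free2_eval -lock; split.
Qed.

Lemma free2_eval1 : free2_eval 1 = 1.
Proof. by case: free2_eval_is_monoid_morphism. Qed.

Lemma free2_evalM u v : free2_eval (u * v) = free2_eval u * free2_eval v.
Proof. by case: free2_eval_is_monoid_morphism. Qed.

Lemma free2_evalx : free2_eval (fx K) = X.
Proof. by rewrite free2_evalU scale1r /word_eval fmU big_seq1. Qed.

Lemma free2_evald : free2_eval (fd K) = D.
Proof. by rewrite free2_evalU scale1r /word_eval fmU big_seq1. Qed.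

Hypothesis DX : D * X = q *: (X * D) + 1.

Lemma free2_eval_rel : free2_eval (qweyl_rel q) = 0.
Proof.
rewrite /qweyl_rel free2_evalB [X in X - _]free2_evalB free2_eval1 free2_evalZ.
by rewrite !free2_evalM free2_evalx free2_evald DX [_ + 1]addrC addrK subrr.
Qed.

Definition qweyl_lift (u : qweyl q) : A := free2_eval (repr u).

(** Two representatives differ by an element of the ideal of the relation, which evaluates to 0. *)
Lemma qweyl_lift_pi u : qweyl_lift (qweyl_pi q u) = free2_eval u.
Proof.
apply/eqP; rewrite -subr_eq0 /qweyl_lift -free2_evalB.
have : repr (qweyl_pi q u) - u \in tsideal (qweyl_rel q).
  by rewrite -qweyl_pi_eq qweyl_pi_repr.
move=> /tsidealP[s ->]; rewrite free2_eval_sum big1 // => p _.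
by rewrite !free2_evalM free2_eval_rel mulr0 mul0r.
Qed.

Lemma qweyl_lift_is_zmod_morphism : zmod_morphism qweyl_lift.
Proof.
move=> u v; rewrite -[u]qweyl_pi_repr -[v]qweyl_pi_repr.
move: (repr u) (repr v) => {}u {}v.
by rewrite -qweyl_piB 3!qweyl_lift_pi free2_evalB.
Qed.
HB.instance Definition _ :=
  GRing.isZmodMorphism.Build (qweyl q) A qweyl_lift qweyl_lift_is_zmod_morphism.

Lemma qweyl_lift_is_monoid_morphism : monoid_morphism qweyl_lift.
Proof.
split=> [|u v]; first by rewrite -(qweyl_pi1 q) qweyl_lift_pi free2_eval1.
rewrite -[u]qweyl_pi_repr -[v]qweyl_pi_repr.
move: (repr u) (repr v) => {}u {}v.
by rewrite -qweyl_piM 3!qweyl_lift_pi free2_evalM.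
Qed.
HB.instance Definition _ :=
  GRing.isMonoidMorphism.Build (qweyl q) A qweyl_lift qweyl_lift_is_monoid_morphism.

Lemma qweyl_lift_is_scalable : scalable qweyl_lift.
Proof.
move=> c u; rewrite -[u]qweyl_pi_repr; move: (repr u) => {}u.
by rewrite -qweyl_piZE 2!qweyl_lift_pi free2_evalZ.
Qed.
HB.instance Definition _ :=
  GRing.isScalable.Build K (qweyl q) A *:%R qweyl_lift qweyl_lift_is_scalable.

(** Applied at q = 1 to produce the elementary endomorphisms of A_1, and at q = t to produce their
    lifts. *)
Lemma qweyl_universal :
  exists f : {lrmorphism qweyl q -> A}, f (qx q) = X /\ f (qd q) = D.
Proof.
exists qweyl_lift; rewrite /= /qx /qd !qweyl_lift_pi.
by rewrite free2_evalx free2_evald.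
Qed.

End UniversalProperty.

(** * Lifting *)

Section Lift.
Variable F : numFieldType.
Local Notation x := (qx (1 : F) : weyl F).
Local Notation d := (qd (1 : F) : weyl F).
Local Notation t := (laurentT F).
Local Notation xt := (qx t : weylt F).
Local Notation dt := (qd t : weylt F).

Lemma weyl_rel : d * x = x * d + 1.
Proof. by rewrite [LHS]qweylE scale1r. Qed.

(** By linearity it suffices to treat words, by induction from the left: a letter x multiplies the
    symbol by x, and a letter d acts as in [d_nord]. *)
Lemma weyl_nord_surj (u : weyl F) : exists U, u = nord x d U.
Proof.
rewrite -[u]qweyl_pi_repr; move: (repr u) => {}u.
have nordD (v w : weyl F) : (exists V, v = nord x d V) ->
    (exists V, w = nord x d V) -> exists V, v + w = nord x d V.
  by move=> [V ->] [V' ->]; exists (V + V'); rewrite raddfD.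
rewrite [u]monalgE (raddf_sum (qweyl_pi (1 : F))).
elim/big_rec: _ => [|m v _ Sv]; first by exists 0; rewrite raddf0.
apply: nordD => // {v Sv}.
have -> : << u@_m *g m >> = u@_m *: << m >> :> {malg F[{fmonom 'I_2}]}.
  by apply/malgP => k; rewrite mcoeffZ !mcoeffU mulrnAr mulr1.
rewrite /= qweyl_piZE; move: {u}u@_m => c.
suff [V ->] : exists V, qweyl_pi 1 << m >> = nord x d V.
  by exists (c%:P *: V); rewrite nordZ.
case: m => s; elim: s => [|i s [V IH]].
  exists 1; rewrite nord1 -(qweyl_pi1 (1 : F)); congr (qweyl_pi 1 << _ >>).
  by apply: val_inj; exact: (esym (@fm1 _)).
have -> : << FMonom (i :: s) >> = << fmu i >> * << FMonom s >> :> {malg F[{fmonom 'I_2}]}.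
  rewrite malgM_def fgmulUU mul1r; congr << _ >>; apply: val_inj.
  by rewrite [RHS](fmM (fmu i) (FMonom s)) (fmU i).
rewrite qweyl_piM IH; have [->|->] : i = 0 \/ i = 1.
  by case: i => -[|[|//]] lti; [left|right]; apply: val_inj.
  exists ('X%:P * V); rewrite nordCM horner_algX; reflexivity.
exists (V * 'X + dX V); rewrite -(d_nord weyl_rel); reflexivity.
Qed.

Definition liftable (phi : {lrmorphism weyl F -> weyl F}) :=
  exists psi : {lrmorphism weylt F -> weylt F}, endo_red psi =1 phi.

Lemma liftable_comp (phi1 phi2 phi : {lrmorphism weyl F -> weyl F}) :
  liftable phi1 -> liftable phi2 -> phi =1 phi1 \o phi2 -> liftable phi.
Proof.
move=> [psi1 E1] [psi2 E2] E; exists (psi1 \o psi2 : {lrmorphism weylt F -> weylt F}) => v.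
have [u <-] := weyl_red_surj v; rewrite endo_redE E /= -E2 endo_redE -E1 endo_redE.
reflexivity.
Qed.

Lemma liftable_gen (phi : {lrmorphism weyl F -> weyl F}) (X D : weylt F) :
  D * X = t *: (X * D) + 1 -> weyl_red X = phi x -> weyl_red D = phi d ->
  liftable phi.
Proof.
move=> DX Xx Dd; have [psi [psix psid]] := qweyl_universal DX.
exists (psi : {lrmorphism weylt F -> weylt F}).
apply: (@endo_ext F (weyl F) x d weyl_nord_surj (endo_red psi) phi).
  by rewrite /= -[X in endo_red _ X]weyl_redx endo_redE psix Xx.
by rewrite /= -[X in endo_red _ X]weyl_redd endo_redE psid Dd.
Qed.

(** H is c evaluated at u, with the coefficients in F lifted to constant Laurent polynomials. *)
Lemma horner_alg_lift (u : weylt F) (c : {poly F}) :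
  exists2 H : weylt F, H * u = u * H & weyl_red H = horner_alg (weyl_red u : weyl F) c.
Proof.
elim/poly_ind: c => [|c k [H Hu HE]].
  by exists 0; rewrite ?mul0r ?mulr0 // !raddf0.
exists (H * u + (laurent_poly k%:P)%:A).
  by rewrite mulrDl mulrDr mulrA -Hu -scalerAl -scalerAr mul1r mulr1.
rewrite raddfD /= weyl_redM HE weyl_redZ weyl_red1 eval1_poly hornerC.
by rewrite raddfD /= rmorphM /= horner_algX horner_algC.
Qed.

(** By [xt_rel] this is (t - 1) x d + 1. *)
Definition zt : weylt F := dt * xt - xt * dt.

Lemma xt_rel : dt * xt = t *: (xt * dt) + 1.
Proof. exact: qweylE. Qed.

(** Rewriting d x once in each of d x x and x d x produces the same extra term x, which cancels in
    the difference. *)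
Lemma zt_x : zt * xt = t *: (xt * zt).
Proof.
have E1 : dt * xt * xt = t *: (xt * (dt * xt)) + xt.
  by rewrite {1}xt_rel mulrDl mul1r -scalerAl mulrA.
have E2 : xt * dt * xt = t *: (xt * (xt * dt)) + xt.
  by rewrite -mulrA xt_rel mulrDr mulr1 -scalerAr.
by rewrite /zt mulrBl mulrBr E1 E2 opprD addrACA subrr addr0 -scalerBr.
Qed.

Lemma dt_zt : dt * zt = t *: (zt * dt).
Proof.
have E1 : dt * (dt * xt) = t *: (dt * xt * dt) + dt.
  by rewrite {1}xt_rel mulrDr mulr1 -scalerAr mulrA.
have E2 : dt * (xt * dt) = t *: (xt * dt * dt) + dt.
  by rewrite mulrA xt_rel mulrDl mul1r -scalerAl.
by rewrite /zt mulrBl mulrBr E1 E2 opprD addrACA subrr addr0 -scalerBr.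
Qed.

Lemma weyl_red_zt : weyl_red zt = 1.
Proof.
rewrite /zt weyl_redB !weyl_redM weyl_redx weyl_redd.
by rewrite weyl_rel addrAC subrr add0r.
Qed.

Lemma exists_qcentral : exists z : weylt F,
  [/\ z * xt = t *: (xt * z), dt * z = t *: (z * dt) & weyl_red z = 1].
Proof. by exists zt; split; [exact: zt_x | exact: dt_zt | exact: weyl_red_zt]. Qed.

Lemma liftable_upper (phi : {lrmorphism weyl F -> weyl F}) (k : F) (c : {poly F}) :
  k != 0 -> phi x = k *: x -> phi d = k^-1 *: d + horner_alg x c -> liftable phi.
Proof.
move=> k0 phix phid; have [H Hx HE] := horner_alg_lift xt c.
pose K := laurent_poly k%:P; pose K' := laurent_poly (k^-1)%:P.
have KK : K' * K = 1 by rewrite -rmorphM -polyCM mulVf // rmorph1.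
have [z [zx _ z1]] := exists_qcentral.
(* Since H commutes with x, the added term satisfies (H z) x = t x (H z) and leaves the relation
   intact; at t = 1 it becomes c(x). *)
apply: (@liftable_gen phi (K *: xt) (K' *: dt + H * z)).
- rewrite mulrDl mulrDr -!scalerAl -!scalerAr !scalerA KK scale1r -[H * z * xt]mulrA zx.
  rewrite -scalerAr scalerDr !scalerA [K * K']mulrC KK mulr1 xt_rel addrAC.
  by rewrite mulrA Hx -mulrA [K * t]mulrC.
- by rewrite weyl_redZ eval1_poly hornerC weyl_redx phix.
rewrite raddfD /= weyl_redZ eval1_poly hornerC weyl_redd weyl_redM HE z1.
by rewrite mulr1 weyl_redx phid.
Qed.

Lemma liftable_lower (phi : {lrmorphism weyl F -> weyl F}) (c : {poly F}) :
  phi x = x + horner_alg d c -> phi d = d -> liftable phi.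
Proof.
move=> phix phid; have [H Hd HE] := horner_alg_lift dt c.
have [z [_ dz z1]] := exists_qcentral.
(* Symmetrically, d (z H) = t (z H) d because H commutes with d. *)
apply: (@liftable_gen phi (xt + z * H) dt).
- rewrite mulrDl mulrDr scalerDr xt_rel addrAC; congr (_ + _ + _).
  by rewrite mulrA dz -scalerAl -!mulrA Hd.
- by rewrite raddfD /= weyl_redx weyl_redM z1 mul1r HE weyl_redd phix.
by rewrite weyl_redd phid.
Qed.

Lemma tame_liftable (phi : {lrmorphism weyl F -> weyl F}) :
  tame x d phi -> liftable phi.
Proof.
elim=> [psi k c|psi c|psi1 psi2 psi _ L1 _ L2].
- exact: liftable_upper.
- exact: liftable_lower.
exact: liftable_comp.
Qed.

Theorem automorphism_liftable (phi : {lrmorphism weyl F -> weyl F}) :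
  bijective phi -> liftable phi.
Proof.
move=> bij; apply: tame_liftable; apply: (dixmier weyl_rel weyl_nord_surj _ bij).
move=> X D DX; apply: (@qweyl_universal F 1 (weyl F) X D).
by rewrite scale1r.
Qed.

End Lift.

Theorem mainTheorem7 (R : realType)
  (phi : {lrmorphism weyl R[i] -> weyl R[i]}) (phi_bij : bijective phi) :
  exists phit : {lrmorphism weylt R[i] -> weylt R[i]}, endo_red phit =1 phi.
Proof. exact: (@automorphism_liftable R[i]). Qed.
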